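(* Let $\hat\lambda=\min\left\{\frac{\nu}{4C_I^2H^2},\frac{\mu}{2}\right\}$. Let $u\in V$ be a steady Navier-Stokes solution, $\epsilon\in V$ the noise function, $u_0\in V$, and let $(u_k)_{k\ge0}\subset V$ be the CDA-Picard iterates with noisy data, defined by $$\nu(\nabla u_{k+1},\nabla v)+b(u_k,u_{k+1},v)+\mu\big(I_Hu_{k+1}-I_H(u+\epsilon),\,I_Hv\big)=(f,v)\qquad\forall v\in V .$$ For any $\nu>0$, $\alpha>0$ and $\mu>0$, the $(k+1)$-st iterate satisfies $$\frac{\nu}{2}\|\nabla u_{k+1}\|^2+\hat\lambda\|u_{k+1}\|^2\le\nu^{-1}\|f\|_{-1}^2+2\mu C_I^2C_P^2\nu^{-2}\|f\|_{-1}^2+2\mu\|I_H\epsilon\|^2 .$$ Furthermore, if $\mu\le\frac{\nu}{2C_I^2H^2}$, then $$\|u_{k+1}\|^2\le 2\mu^{-1}\nu^{-1}\|f\|_{-1}^2+4C_I^2C_P^2\nu^{-2}\|f\|_{-1}^2+4\|I_H\epsilon\|^2 .$$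
   Context: $\Omega\subset\mathbb{R}^d$, $d\in\{2,3\}$, is an open connected set that is a convex polygon or has smooth boundary. $(\cdot,\cdot)$ and $\|\cdot\|$ denote the $L^2(\Omega)$ inner product and norm. $X=\{v\in H^1(\Omega)^d: v=0\text{ on }\partial\Omega\}$, $Q=\{q\in L^2(\Omega):\int_\Omega q\,dx=0\}$, $V=\{v\in X:(\nabla\cdot v,q)=0\ \forall q\in Q\}$ (the divergence-free subspace). $C_P$ is the Poincaré constant: $\|\phi\|\le C_P\|\nabla\phi\|$ for all $\phi\in X$. $\nu>0$ is the viscosity, $f\in H^{-1}(\Omega)^d$ is the forcing, $(f,v)=\langle f,v\rangle$ is the duality pairing, and $\|\cdot\|_{-1}$ is the $H^{-1}$ norm (dual to $\|\nabla\cdot\|$). $b(u,w,v)=((u\cdot\nabla)w,v)$. $M$ is a constant depending only on $\Omega$ such that $b(u,w,v)\le M\|u\|^{1/2}\|\nabla u\|^{1/2}\|\nabla w\|\|\nabla v\|$ and $b(u,w,v)\le M\|\nabla u\|\|\nabla w\|\|\nabla v\|$ for $u,w,v\in X$; $\alpha:=M\nu^{-2}\|f\|_{-1}$. A steady Navier-Stokes solution is a $u\in V$ with $\nu(\nabla u,\nabla v)+b(u,u,v)=\langle f,v\rangle$ for all $v\in V$; the paper assumes throughout that $\|\nabla u\|_{L^\infty}<\infty$. Data assimilation: $H>0$ is the width of a coarse mesh of $\Omega$, and $I_H$ is a (linear) coarse mesh interpolation operator for which there is a constant $C_I>0$ independent of $H$ with $\|I_Hv-v\|\le C_IH\|\nabla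 v\|$ and $\|I_Hv\|\le C_I\|v\|$ for all $v\in X$. $\mu>0$ is the nudging parameter. The known data are $u(x_i)+\epsilon_i$ at measurement points $x_i$; $\epsilon\in V$ is any divergence-free function with $I_H\epsilon(x_i)=\epsilon_i$, and $\delta$ denotes a (relative noise size) constant, $\delta\ge 0$, with $\|\nabla(u+\epsilon)\|\le(1+\delta)\|\nabla u\|$. *)

(* Defs.v *)
From HB Require Import structures.
From mathcomp Require Import all_boot all_order all_algebra.
From mathcomp Require Import all_classical all_reals all_analysis.

Set Implicit Arguments.
Unset Strict Implicit.
Unset Printing Implicit Defensive.

Import Order.TTheory GRing.Theory Num.Theory.
Import numFieldNormedType.Exports.

Local Open Scope classical_set_scope.
Local Open Scope ring_scope.

(* As n.-tuple in the library, row vectors carry the product sigma-algebra,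
   generated by the coordinate projections. *)
Definition rV_display : measure_display.
Proof. exact: default_measure_display. Qed.

Definition rV_coor (R : realType) (n : nat) (i : 'I_n) (x : 'rV[R]_n) :
  measurableTypeR R := x ord0 i.

Section measurable_rV.
Context {R : realType} {n : nat}.

Let rV_set0 : g_sigma_preimage (@rV_coor R n) set0.
Proof. exact: sigma_algebra0. Qed.

Let rV_setC A : g_sigma_preimage (@rV_coor R n) A ->
  g_sigma_preimage (@rV_coor R n) (~` A).
Proof. exact: sigma_algebraC. Qed.

Let rV_bigcup (F : (set 'rV[R]_n)^nat) :
  (forall i, g_sigma_preimage (@rV_coor R n) (F i)) ->
  g_sigma_preimage (@rV_coor R n) (\bigcup_i (F i)).
Proof. exact: sigma_algebra_bigcup. Qed.

HB.instance Definition _ := @isMeasurable.Build rV_display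
  'rV[R]_n (g_sigma_preimage (@rV_coor R n)) rV_set0 rV_setC rV_bigcup.

End measurable_rV.

Section measurable_rV_lemmas.
Context {R : realType}.

Lemma measurable_rV_coor (n : nat) (i : 'I_n) :
  measurable_fun setT (@rV_coor R n i).
Proof.
move=> _ A mA; rewrite setTI; apply: sub_sigma_algebra => /=.
rewrite -bigcup_seq/=; exists i => /=; first by rewrite mem_index_enum.
by exists A => //; rewrite setTI.
Qed.

Lemma measurable_fun_rV (n : nat) d (T : measurableType d) (f : T -> 'rV[R]_n) :
  (forall i, measurable_fun setT (rV_coor i \o f)) -> measurable_fun setT f.
Proof.
move=> mf.
suff prefS : g_sigma_preimage (fun i => @rV_coor R n i \o f) `<=` measurable.
  rewrite g_sigma_preimage_comp in prefS.
  by move=> _ A mA; apply: prefS; exists A.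
apply: smallest_sub; first exact: sigma_algebra_measurable.
rewrite -bigcup_seq/=; apply: bigcup_sub => i _.
by move=> A [B mB <-]; exact: mf.
Qed.

Definition rV_cons (n : nat) (p : measurableTypeR R * 'rV[R]_n) : 'rV[R]_n.+1 :=
  \row_i (if unlift ord0 i is Some j then p.2 ord0 j else p.1).

Definition rV_uncons (n : nat) (x : 'rV[R]_n.+1) : measurableTypeR R * 'rV[R]_n :=
  (rV_coor ord0 x, \row_i x ord0 (lift ord0 i)).

Lemma rV_consE0 (n : nat) p : rV_coor ord0 (@rV_cons n p) = p.1.
Proof. by rewrite /rV_coor mxE unlift_none. Qed.

Lemma rV_consK (n : nat) : cancel (@rV_cons n) (@rV_uncons n).
Proof.
move=> p; rewrite /rV_uncons rV_consE0; case: p => a v; congr (_, _).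
by apply/rowP => i; rewrite !mxE liftK.
Qed.

Lemma measurable_rV_cons (n : nat) : measurable_fun setT (@rV_cons n).
Proof.
apply: measurable_fun_rV => i.
have [->|] := eqVneq i ord0.
  by apply: (eq_measurable_fun fst) => // p _ /=; rewrite rV_consE0.
case: (unliftP ord0 i) => [j ->|->]; last by rewrite eqxx.
move=> _; apply: (eq_measurable_fun (rV_coor j \o snd)) => [p _|].
  by rewrite /rV_coor /= mxE liftK.
by apply: measurableT_comp => //; exact: measurable_rV_coor.
Qed.

Lemma measurable_rV_uncons (n : nat) : measurable_fun setT (@rV_uncons n).
Proof.
apply: measurable_fun_pair; first exact: measurable_rV_coor.
apply: measurable_fun_rV => i.
apply: (eq_measurable_fun (rV_coor (lift ord0 i))).
  by move=> x _; rewrite /rV_coor /= mxE.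
exact: measurable_rV_coor.
Qed.

End measurable_rV_lemmas.

Section lebesgue_rV_cons.
Context {R : realType} (n : nat).
Variable m : {sigma_finite_measure set 'rV[R]_n -> \bar R}.

Local Notation pm := (@lebesgue_measure R \x m)%E.

Definition rV_cons_measure : set 'rV[R]_n.+1 -> \bar R :=
  pushforward pm (@rV_cons R n).

Let m0 : rV_cons_measure set0 = 0%E.
Proof. by rewrite /rV_cons_measure /pushforward preimage_set0 measure0. Qed.

Let m_ge0 A : (0 <= rV_cons_measure A)%E.
Proof. by apply: integral_ge0 => x _; exact: measure_ge0. Qed.

Let m_sigma_additive : semi_sigma_additive rV_cons_measure.
Proof.
move=> F mF tF mUF; rewrite /rV_cons_measure /pushforward preimage_bigcup.
apply: measure_semi_sigma_additive.
- by move=> k; rewrite -[X in measurable X]setTI; exact: measurable_rV_cons.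
- apply/trivIsetP => /= i j _ _ ij; rewrite -preimage_setI.
  by move/trivIsetP : tF => /(_ _ _ _ _ ij) ->//; rewrite preimage_set0.
- by rewrite -preimage_bigcup -[X in measurable X]setTI; exact: measurable_rV_cons.
Qed.

HB.instance Definition _ := isMeasure.Build _ _ _ rV_cons_measure
  m0 m_ge0 m_sigma_additive.

Let m_sigma_finite : sigma_finite setT rV_cons_measure.
Proof.
have /sigma_finiteP[F [FT ndF Foo]] := sigma_finiteT (@lebesgue_measure R).
have /sigma_finiteP[G [GT ndG Goo]] := sigma_finiteT m.
exists (fun k => @rV_uncons R n @^-1` (F k `*` G k)).
  apply/esym/seteqP; split=> // x _.
  have [k _ Fk] : (\bigcup_k F k) (rV_uncons x).1 by rewrite -FT.
  have [l _ Gl] : (\bigcup_k G k) (rV_uncons x).2 by rewrite -GT.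
  exists (maxn k l) => //; split.
    by move: Fk; exact/subsetPset/ndF/leq_maxl.
  by move: Gl; exact/subsetPset/ndG/leq_maxr.
move=> k; have [mF Fk] := Foo k; have [mG Gk] := Goo k; split.
  rewrite -[X in measurable X]setTI; apply: measurable_rV_uncons => //.
  exact: measurableX.
rewrite /rV_cons_measure /pushforward -comp_preimage.
rewrite (_ : _ \o _ = id); last by apply/funext => p /=; rewrite rV_consK.
rewrite preimage_id product_measure1E// lte_mul_pinfty// ge0_fin_numE//.
Qed.

HB.instance Definition _ := Measure_isSigmaFinite.Build _ _ _ rV_cons_measure
  m_sigma_finite.

End lebesgue_rV_cons.

Section pde.
Context {R : realType}.

(* Lebesgue measure on R^d, by iterated products. *)
Fixpoint leb (d : nat) : {sigma_finite_measure set 'rV[R]_d -> \bar R} :=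
  match d with
  | 0 => \d_(0 : 'rV[R]_0)
  | d'.+1 => rV_cons_measure (leb d')
  end.

Section fixed_dimension.
Context {d : nat}.
Implicit Types (Omega : set 'rV[R]_d) (f g : 'rV[R]_d -> R)
  (u v w : 'rV[R]_d -> 'rV[R]_d).

Definition partial (j : 'I_d) f : 'rV[R]_d -> R := 'D_(delta_mx ord0 j) f.

(* C^oo: every iterated partial derivative is differentiable. *)
Definition smooth f := forall (s : seq 'I_d) (x : 'rV[R]_d),
  differentiable (foldr partial f s) x.

Definition test_fun Omega f := smooth f /\
  exists K : set 'rV[R]_d,
    [/\ compact K, K `<=` Omega & forall x, ~ K x -> f x = 0].

Definition boundary Omega := closure Omega `\` interior Omega.

(* Convex polytopes: polygons for d = 2, polyhedra for d = 3. *)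
Definition convex_polygon Omega := exists (n : nat) (p : 'I_n -> 'rV[R]_d),
  Omega = interior [set x | exists t : 'I_n -> R,
    [/\ forall i, 0 <= t i, \sum_i t i = 1 & x = \sum_i t i *: p i]].

(* C^oo boundary, by local defining functions with nonzero gradient. *)
Definition smooth_boundary Omega := forall x, boundary Omega x ->
  exists rho, [/\ smooth rho, exists j, partial j rho x != 0 &
    \forall y \near x, Omega y <-> rho y < 0].

Definition ns_domain Omega :=
  [/\ open Omega, connected Omega &
      convex_polygon Omega \/ smooth_boundary Omega].

Definition L2 Omega f := measurable_fun Omega f /\
  (leb d).-integrable Omega (fun x => (f x ^+ 2)%:E).

Definition weak_partial Omega (j : 'I_d) f g := forall phi,
  test_fun Omega phi ->
  \int[leb d]_(x in Omega) (f x * partial j phi x) =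
  - \int[leb d]_(x in Omega) (g x * phi x).

Definition H1space Omega f := L2 Omega f /\
  forall j, exists2 g, L2 Omega g & weak_partial Omega j f g.

(* The weak partial derivative of f : H1, unique up to null sets; a
   representative is chosen. *)
Definition wderiv Omega (j : 'I_d) f : 'rV[R]_d -> R :=
  xget (cst 0) [set g | L2 Omega g /\ weak_partial Omega j f g].

(* H1 functions vanishing on the boundary in the sense of traces: the closure
   of the test functions in H1. *)
Definition H10space Omega f := H1space Omega f /\
  exists phi : nat -> 'rV[R]_d -> R,
    [/\ forall n, test_fun Omega (phi n),
        (fun n => \int[leb d]_(x in Omega) ((f x - phi n x) ^+ 2))
          @ \oo --> (0 : R) &
        forall j, (fun n => \int[leb d]_(x in Omega)
            ((wderiv Omega j f x - partial j (phi n) x) ^+ 2))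
          @ \oo --> (0 : R)].

Definition dotmx (m n : nat) (A B : 'M[R]_(m, n)) : R :=
  \sum_i \sum_j A i j * B i j.

Definition inner Omega (m n : nat) (F G : 'rV[R]_d -> 'M[R]_(m, n)) : R :=
  \int[leb d]_(x in Omega) dotmx (F x) (G x).

Definition norm2 Omega (m n : nat) (F : 'rV[R]_d -> 'M[R]_(m, n)) : R :=
  Num.sqrt (inner Omega F F).

Definition component (i : 'I_d) v : 'rV[R]_d -> R := fun x => v x ord0 i.

(* (grad v)_(i, j) = d v_i / d x_j *)
Definition grad Omega v (x : 'rV[R]_d) : 'M[R]_d :=
  \matrix_(i, j) wderiv Omega j (component i v) x.

Definition Xspace Omega v := forall i, H10space Omega (component i v).

(* The extended-real integral is 0 only if q is integrable, so this also makes
   sense when Omega has infinite measure. *)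
Definition Qspace Omega (q : 'rV[R]_d -> R) := L2 Omega q /\
  (\int[leb d]_(x in Omega) (q x)%:E = 0)%E.

Definition Vspace Omega v := Xspace Omega v /\ forall q, Qspace Omega q ->
  \int[leb d]_(x in Omega) (\tr (grad Omega v x) * q x) = 0.

Definition poincare Omega (CP : R) := forall v, Xspace Omega v ->
  norm2 Omega v <= CP * norm2 Omega (grad Omega v).

(* ((u . grad) w)_i = sum_j u_j d w_i / d x_j *)
Definition convect Omega u w (x : 'rV[R]_d) : 'rV[R]_d :=
  u x *m (grad Omega w x)^T.

Definition bform Omega u w v : R := inner Omega (convect Omega u w) v.

(* The integral defining b must exist for the bounds to be meaningful. *)
Definition b_bound Omega (M : R) := forall u w v,
  Xspace Omega u -> Xspace Omega w -> Xspace Omega v ->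
  [/\ (leb d).-integrable Omega
        (fun x => (dotmx (convect Omega u w x) (v x))%:E),
      bform Omega u w v <= M * Num.sqrt (norm2 Omega u) *
        Num.sqrt (norm2 Omega (grad Omega u)) *
        norm2 Omega (grad Omega w) * norm2 Omega (grad Omega v) &
      bform Omega u w v <= M * norm2 Omega (grad Omega u) *
        norm2 Omega (grad Omega w) * norm2 Omega (grad Omega v)].

(* H^-1(Omega)^d as the dual of X normed by ||grad v||; F v stands for the
   pairing <F, v>. *)
Definition Hm1space Omega (F : ('rV[R]_d -> 'rV[R]_d) -> R) :=
  (forall (a : R) v w, Xspace Omega v -> Xspace Omega w ->
    F (a *: v + w) = a * F v + F w) /\
  exists C : R, forall v, Xspace Omega v ->
    `|F v| <= C * norm2 Omega (grad Omega v).

Definition norm_m1 Omega (F : ('rV[R]_d -> 'rV[R]_d) -> R) : R :=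
  sup [set F v | v in [set v | Xspace Omega v /\ norm2 Omega (grad Omega v) <= 1]].

Definition alpha Omega (M nu : R) F : R := M * nu ^- 2 * norm_m1 Omega F.

Definition steady_NSE Omega (nu : R) F u := Vspace Omega u /\
  forall v, Vspace Omega v ->
    nu * inner Omega (grad Omega u) (grad Omega v) + bform Omega u u v = F v.

Definition grad_Linfty Omega u := exists C : R,
  {ae leb d, forall x, Omega x -> forall i j, `|grad Omega u x i j| <= C}.

(* Interpolants are L2 fields, hence linearity only up to null sets. *)
Definition interpolation Omega (CI H : R)
    (I : ('rV[R]_d -> 'rV[R]_d) -> 'rV[R]_d -> 'rV[R]_d) :=
  [/\ forall (a : R) v w, Xspace Omega v -> Xspace Omega w ->
        {ae leb d, forall x, Omega x -> I (a *: v + w) x = a *: I v x + I w x},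
      forall v, Xspace Omega v -> forall i, L2 Omega (component i (I v)),
      forall v, Xspace Omega v ->
        norm2 Omega (I v - v) <= CI * H * norm2 Omega (grad Omega v) &
      forall v, Xspace Omega v -> norm2 Omega (I v) <= CI * norm2 Omega v].

(* The CDA-Picard iteration, with data u + eps nudged through I. *)
Definition cda_picard Omega (nu mu : R)
    (I : ('rV[R]_d -> 'rV[R]_d) -> 'rV[R]_d -> 'rV[R]_d) F
    (u eps : 'rV[R]_d -> 'rV[R]_d)
    (u_ : nat -> 'rV[R]_d -> 'rV[R]_d) :=
  (forall k, Vspace Omega (u_ k)) /\
  forall k v, Vspace Omega v ->
    nu * inner Omega (grad Omega (u_ k.+1)) (grad Omega v) +
    bform Omega (u_ k) (u_ k.+1) v +
    mu * inner Omega (I (u_ k.+1) - I (u + eps)) (I v) = F v.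

Definition lambda_hat (nu mu CI H : R) : R :=
  Num.min (nu / (4 * CI ^+ 2 * H ^+ 2)) (mu / 2).

End fixed_dimension.
End pde.

(* Main.v *)
Require Import Defs.
From mathcomp Require Import all_boot all_order all_algebra.
From mathcomp Require Import all_classical all_reals all_analysis.
From mathcomp Require Import measurable_realfun.
From mathcomp Require Import ring lra.

Set Implicit Arguments.
Unset Strict Implicit.
Unset Printing Implicit Defensive.

Import Order.TTheory GRing.Theory Num.Theory.
Import numFieldNormedType.Exports.

Local Open Scope classical_set_scope.
Local Open Scope ring_scope.

(** This is an energy estimate. Test the equation of the iterate v = u_(k+1)
    with v itself. The convection term vanishes, b(u_k, v, v) = 0, and leaves

      nu |grad v|^2 + mu |I v|^2 = <f, v> + mu (I u + I eps, I v).

    With <f, v> <= |f|_(-1) |grad v|, Young's inequality absorbs half of the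
    left-hand side and gives

      nu |grad v|^2 + mu |I v|^2 <= |f|_(-1)^2 / nu + mu |I u + I eps|^2.

    On the right, |I u| <= C_I C_P |grad u|, and |grad u| <= |f|_(-1) / nu by
    the same test in the equation of u. On the left, the approximation property
    |v|^2 <= 2 |I v|^2 + 2 (C_I H |grad v|)^2 and the two bounds that define
    lambda turn mu |I v|^2 + (nu / 2) |grad v|^2 into a multiple of |v|^2
    ([energy_balance]). The second estimate is the case lambda = mu / 2.

    Two facts need analysis. They are immediate for smooth fields, and the work
    is to carry them over to weak derivatives.

    - <f, v> <= |f|_(-1) |grad v| ([Hm1_le]). The dual norm is a supremum over
      the unit ball of X, so X must be stable under scaling and the gradient
      homogeneous. Since the weak derivative is an arbitrary representative,
      this rests on its uniqueness almost everywhere, hence on the density of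
      test functions in L2: an L2 function orthogonal to all of them is zero
      ([test_fun_dense]). Products of scaled copies of exp(-1/t) are smooth bumps
      that increase to the indicator of a box, so such a function has integral
      zero on every box inside Omega, and boxes generate the sigma-algebra.

    - b(w, v, v) = 0 for w in V and v in X ([bform_skew]). For a test field v
      it is the integral of w . grad (|v|^2 / 2), that is minus the integral of
      (div w) |v|^2 / 2, which is zero ([V_ip_test]). Both sides are continuous
      in v for the gradient norm by the assumed bound on b, and test fields are
      dense in X ([X_approx]). *)

(** * Boxes and the sigma-algebra of row vectors *)

Section boxes.
Context {R : realType} {n : nat}.
Implicit Types (a b x : 'rV[R]_n) (U : set 'rV[R]_n).

Definition obox a b : set 'rV[R]_n :=
  [set x | forall i, a ord0 i < x ord0 i < b ord0 i].

Definition cbox a b : set 'rV[R]_n :=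
  [set x | forall i, a ord0 i <= x ord0 i <= b ord0 i].

Lemma obox_cbox a b : obox a b `<=` cbox a b.
Proof. by move=> x xab i; have /andP[/ltW-> /ltW->] := xab i. Qed.

Lemma measurable_rVcap (P : 'I_n -> set R) :
  (forall i, measurable (P i)) ->
  measurable [set x : 'rV[R]_n | forall i, P i (x ord0 i)].
Proof.
move=> mP.
have -> : [set x : 'rV[R]_n | forall i, P i (x ord0 i)] =
    \bigcap_(i in [set: 'I_n]) (@rV_coor R n i @^-1` P i).
  by apply/seteqP; split=> x /= xP; [move=> i _; exact: xP|move=> i; exact: xP].
apply: fin_bigcap_measurable => // i _.
rewrite -[X in measurable X]setTI.
by apply: (@measurable_rV_coor R n i measurableT (P i)); exact: mP.
Qed.

Lemma measurable_obox a b : measurable (obox a b).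
Proof.
apply: (measurable_rVcap (P := fun i => `]a ord0 i, b ord0 i[%classic)) => i.
exact: measurable_itv.
Qed.

Lemma measurable_cbox a b : measurable (cbox a b).
Proof.
apply: (measurable_rVcap (P := fun i => `[a ord0 i, b ord0 i]%classic)) => i.
exact: measurable_itv.
Qed.

Definition rat_row (q : 'rV[rat]_n) : 'rV[R]_n := map_mx ratr q.

(** Rational corners make the boxes inside an open set countable; this gives
    the measurability of open sets, and later reduces statements almost
    everywhere on Omega to boxes. *)
Lemma open_rat_box U x : open U -> U x ->
  exists p : 'rV[rat]_n * 'rV[rat]_n,
    obox (rat_row p.1) (rat_row p.2) x /\
    cbox (rat_row p.1) (rat_row p.2) `<=` U.
Proof.
move=> oU Ux.
have /nbhs_ballP[e /= e0 eU] : nbhs x U by exact: open_nbhs_nbhs.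
have lo i : exists q : rat, ratr q \in `]x ord0 i - e, x ord0 i[.
  by apply: rat_in_itvoo; rewrite ltrBlDr ltrDl.
have hi i : exists q : rat, ratr q \in `]x ord0 i, x ord0 i + e[.
  by apply: rat_in_itvoo; rewrite ltrDl.
exists (\row_i xchoose (lo i), \row_i xchoose (hi i)); split.
  move=> i; rewrite !mxE.
  have := xchooseP (lo i); rewrite in_itv/= => /andP[_ ->].
  by have := xchooseP (hi i); rewrite in_itv/= => /andP[-> _].
move=> y yB; apply: eU; split=> // i j; rewrite (ord1 i).
have := yB j; rewrite !mxE.
have := xchooseP (lo j); rewrite in_itv/= => /andP[h1 _].
have := xchooseP (hi j); rewrite in_itv/= => /andP[_ h2] /andP[h3 h4].
by rewrite /ball/= ltr_distl; apply/andP; split; lra.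
Qed.

Lemma open_measurable_rV U : open U -> measurable U.
Proof.
move=> oU.
have -> : U = \bigcup_(p : 'rV[rat]_n * 'rV[rat]_n)
    (if `[< cbox (rat_row p.1) (rat_row p.2) `<=` U >]
     then obox (rat_row p.1) (rat_row p.2) else set0).
  apply/seteqP; split=> [x Ux|x [p _]].
    have [p [px pU]] := open_rat_box oU Ux.
    by exists p => //; rewrite (asboolT pU).
  by case: asboolP => // pU /obox_cbox/pU.
apply: countable_bigcupT_measurable => [|p].
  exact: (@countableP ('rV[rat]_n * 'rV[rat]_n)%type).
by case: ifP => _ //; exact: measurable_obox.
Qed.

Lemma continuous_measurable_rV (f : 'rV[R]_n -> R) :
  continuous f -> measurable_fun setT f.
Proof.
move=> /continuousP cf.
apply: (measurability _ (RGenOpens.measurableE R)) => /=.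
move=> _ [_ [a [b ->] <-]]; rewrite setTI; apply: open_measurable_rV.
by apply: cf; exact: interval_open.
Qed.

(** The sigma-algebra is defined from coordinate projections; a strip
    c < x_i < e is the countable union of the boxes that agree with it in
    direction i and have half-width k in the others. *)
Lemma measurable_boxesE :
  @measurable _ ('rV[R]_n) = <<s [set A | exists a b, A = obox a b] >>.
Proof.
apply/seteqP; split; last first.
  apply: smallest_sub; first exact: sigma_algebra_measurable.
  by move=> _ [a [b ->]]; exact: measurable_obox.
apply: smallest_sub; first exact: smallest_sigma_algebra.
rewrite -bigcup_seq/=; apply: bigcup_sub => i _ _ [B mB <-]; rewrite setTI.
move: mB; rewrite RGenOpens.measurableE => mB.
pose S := [set A | exists a b, A = obox a b].
suff : preimage_set_system setT (@rV_coor R n i) <<s @RGenOpens.G R >> `<=`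
    <<s S >> by apply; exists B => //; rewrite setTI.
rewrite -g_sigma_preimageE; apply: smallest_sub.
  exact: smallest_sigma_algebra.
move=> _ [_ [c [e ->]] <-]; rewrite setTI.
have -> : rV_coor i @^-1` `]c, e[%classic = \bigcup_k
    obox (\row_j (if j == i then c else - k%:R))
         (\row_j (if j == i then e else k%:R)).
  apply/seteqP; split=> [x /= xce|x [k _ /(_ i)]]; last first.
    by rewrite !mxE eqxx /= in_itv.
  exists (Num.truncn `|x|).+1 => // j; rewrite !mxE.
  case: eqP => [->|_]; first by move: xce; rewrite in_itv.
  rewrite -ltr_norml; apply: (@le_lt_trans _ _ `|x|); last first.
    exact: truncnS_gt.
  rewrite [leRHS]mx_normrE.
  by apply: (le_trans _ (le_bigmax _ _ (ord0, j))).
apply: sigma_algebra_bigcup => k.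
by apply: sub_sigma_algebra; exists (\row_j (if j == i then c else - k%:R)),
  (\row_j (if j == i then e else k%:R)).
Qed.

End boxes.

(** * Integrability of continuous functions with bounded support *)

Section bounded_support.
Context {R : realType}.

Lemma leb_cbox_fin n (a b : 'rV[R]_n) : (leb n (cbox a b) < +oo)%E.
Proof.
elim: n => [|n IHn] in a b *.
  by rewrite /= diracE; case: (_ \in _); rewrite ltry.
have -> : leb n.+1 (cbox a b) =
   (@lebesgue_measure R \x leb n)%E (`[a ord0 ord0, b ord0 ord0]%classic `*`
     cbox (\row_i a ord0 (lift ord0 i)) (\row_i b ord0 (lift ord0 i))).
  rewrite /= /rV_cons_measure /pushforward; congr (_ _).
  apply/seteqP; split=> [[t y] h|[t y] [/= h1 h2] i].
    split=> /=.
      by have := h ord0; rewrite /rV_cons mxE unlift_none /= in_itv.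
    by move=> i; rewrite !mxE; have := h (lift ord0 i); rewrite /rV_cons mxE liftK.
  rewrite /rV_cons mxE; case: unliftP => [k|] ->.
    by have := h2 k; rewrite !mxE.
  by move: h1; rewrite in_itv.
rewrite product_measure1E//; [|exact: measurable_cbox].
apply: lte_mul_pinfty => //.
rewrite ge0_fin_numE//.
apply: (@le_lt_trans _ _
  (lebesgue_measure `[a ord0 ord0, b ord0 ord0]%classic)) => //.
by rewrite lebesgue_measure_itv/=; case: ifP => _; rewrite ltry.
Qed.

(** On the whole space, so that it passes to slices without reference to Omega. *)
Definition bounded_support n (f : 'rV[R]_n -> R) :=
  exists r : R, forall x, r < `|x| -> f x = 0.

Lemma bounded_support_cbox n (f : 'rV[R]_n -> R) : bounded_support f ->
  exists a b, forall x, ~ cbox a b x -> f x = 0.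
Proof.
case=> r fr; exists (const_mx (- r)), (const_mx r) => x xab; apply: fr.
rewrite ltNge; apply/negP => xr; apply: xab => i; rewrite !mxE -ler_norml.
apply: le_trans xr; rewrite [leRHS]mx_normrE.
by apply: (le_trans _ (le_bigmax _ _ (ord0, i))).
Qed.

Lemma bounded_support_integrable n (D : set 'rV[R]_n) (f : 'rV[R]_n -> R)
    (M : R) : measurable D -> measurable_fun setT f ->
  (forall x, `|f x| <= M) -> bounded_support f ->
  (leb n).-integrable D (EFin \o f).
Proof.
move=> mD mf fM /bounded_support_cbox[a [b fab]].
have mB := measurable_cbox a b.
have -> : f = f \_ (cbox a b).
  apply/funext => x; rewrite patchE; case: ifPn => //.
  by rewrite notin_setE => /fab.
rewrite -restrict_EFin; apply/integrable_restrict => //.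
have mDB : measurable (D `&` cbox a b) by exact: measurableI.
apply: (@measurable_bounded_integrable _ _ _ _ f) => //.
- by apply: le_lt_trans (leb_cbox_fin a b); apply: le_measure => //; rewrite inE.
- exact: measurable_funTS.
- exists M; split; first exact: num_real.
  by move=> x Mx y _; apply: le_trans (fM y) _; exact: ltW.
Qed.

Lemma continuous_bounded_support n (f : 'rV[R]_n -> R) : continuous f ->
  bounded_support f -> exists M, forall x, `|f x| <= M.
Proof.
move=> cf [r fr].
have : compact (closed_ball_ (fun x => `|x|) (0 : 'rV[R]_n) (Num.max r 0)).
  apply: bounded_closed_compact; last exact: closed_closed_ball_.
  exists (Num.max r 0); split; first exact: num_real.
  move=> x rx y; rewrite /closed_ball_/= sub0r normrN => /le_trans; apply.
  exact: ltW.
move=> /(continuous_compact (continuous_subspaceT cf))/compact_bounded[M [_ HM]].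
exists (`|M| + 1) => x; have [xr|xr] := leP `|x| (Num.max r 0).
  apply: (HM (`|M| + 1)); first by rewrite (le_lt_trans (ler_norm _))// ltrDl.
  by exists x => //; rewrite /closed_ball_/= sub0r normrN.
by rewrite fr ?normr0 ?addr_ge0//; move: xr; rewrite gt_max => /andP[].
Qed.

Lemma continuous_integrable_rV n (D : set 'rV[R]_n) (f : 'rV[R]_n -> R) :
  measurable D -> continuous f -> bounded_support f ->
  (leb n).-integrable D (EFin \o f).
Proof.
move=> mD cf bf; have [M fM] := continuous_bounded_support cf bf.
exact: bounded_support_integrable (continuous_measurable_rV cf) fM bf.
Qed.

Lemma partial_bounded_support n (j : 'I_n) (f : 'rV[R]_n -> R) r :
  (forall x, r < `|x| -> f x = 0) -> (forall x, r < `|x| -> partial j f x = 0).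
Proof.
move=> fr x rx; rewrite /partial -(derive_cst (0 : R) x (delta_mx ord0 j)).
apply: near_eq_derive.
have /(_ x rx) : open [set y : 'rV[R]_n | r < `|y|].
  by apply: open_comp (@open_gt R r) => y _; exact: norm_continuous.
by move=> h; near=> y; apply: fr; near: y; exact: h.
Unshelve. all: by end_near. Qed.
End bounded_support.

(** * The integral of a derivative with bounded support *)

Section divergence.
Context {R : realType}.

Definition row_cons n (t : R) (y : 'rV[R]_n) : 'rV[R]_n.+1 := rV_cons (t, y).

Lemma row_consE0 n t (y : 'rV[R]_n) : row_cons t y ord0 ord0 = t.
Proof. by rewrite mxE unlift_none. Qed.

Lemma row_consES n t (y : 'rV[R]_n) i : row_cons t y ord0 (lift ord0 i) = y ord0 i.
Proof. by rewrite mxE liftK. Qed.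

Lemma row_cons_shift0 n (h t : R) (y : 'rV[R]_n) :
  row_cons (h + t) y = h *: delta_mx ord0 ord0 + row_cons t y.
Proof.
apply/rowP => i; case: (unliftP ord0 i) => [j|] ->; rewrite mxE ![in RHS]mxE.
  by rewrite liftK /= mulr0 add0r.
by rewrite unlift_none eqxx mulr1.
Qed.

Lemma row_cons_shift n (j : 'I_n) (h t : R) (y : 'rV[R]_n) :
  row_cons t (h *: delta_mx ord0 j + y) =
  h *: delta_mx ord0 (lift ord0 j) + row_cons t y.
Proof.
apply/rowP => i; case: (unliftP ord0 i) => [k|] ->; rewrite mxE ![in RHS]mxE.
  by rewrite liftK /= !mxE (inj_eq lift_inj).
by rewrite unlift_none mulr0 add0r.
Qed.

Lemma row_cons_norm n t (y : 'rV[R]_n) : `|y| <= `|row_cons t y|.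
Proof.
rewrite [leLHS]mx_normrE; apply: bigmax_le => // -[i j] _ /=.
rewrite (ord1 i) -(row_consES t) [leRHS]mx_normrE.
by apply: (le_trans _ (le_bigmax _ _ (ord0, lift ord0 j))).
Qed.

Lemma row_cons_norm0 n t (y : 'rV[R]_n) : `|t| <= `|row_cons t y|.
Proof.
rewrite -[t in leLHS](row_consE0 t y) [leRHS]mx_normrE.
by apply: (le_trans _ (le_bigmax _ _ (ord0, ord0))).
Qed.

Lemma row_cons_continuous n t : continuous (@row_cons n t).
Proof.
move=> y; apply/(@cvgrPdist_lt _ _ _ (nbhs y) (nbhs_filter y)) => e e0; near=> z.
have : `|y - z| < e by near: z; exact: cvgr_dist_lt.
rewrite [X in X < _ -> _]mx_normrE [X in _ -> X < _]mx_normrE => yz.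
apply: bigmax_lt => // -[i j] _ /=; rewrite (ord1 i).
case: (unliftP ord0 j) => [k|] ->.
  rewrite mxE [X in _ + X]mxE !row_consES; apply: le_lt_trans yz.
  have := (le_bigmax (0 : R) (fun i : 'I_1 * 'I_n => `|(y - z) i.1 i.2|) (ord0, k)).
  by rewrite /= !mxE.
by rewrite mxE [X in _ + X]mxE !row_consE0 subrr normr0.
Unshelve. all: by end_near. Qed.

Lemma row_cons_continuousl n (y : 'rV[R]_n) : continuous (fun t => row_cons t y).
Proof.
move=> t; apply/(@cvgrPdist_lt _ _ _ (nbhs t) (nbhs_filter t)) => e e0; near=> s.
have ts : `|t - s| < e by near: s; exact: cvgr_dist_lt.
rewrite [X in X < _]mx_normrE; apply: bigmax_lt => // -[i j] _ /=; rewrite (ord1 i).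
case: (unliftP ord0 j) => [k|] ->.
  by rewrite mxE [X in _ + X]mxE !row_consES subrr normr0.
by rewrite mxE [X in _ + X]mxE !row_consE0.
Unshelve. all: by end_near. Qed.

Lemma row_cons_derivable0 n (f : 'rV[R]_n.+1 -> R) t y :
  derivable f (row_cons t y) (delta_mx ord0 ord0) ->
  derivable (fun s => f (row_cons s y)) t 1.
Proof.
rewrite /derivable => h; set g := (X in cvg (X @ _)).
suff -> : g = (fun h : R => h^-1 *: ((f \o shift (row_cons t y))
  (h *: delta_mx ord0 ord0) - f (row_cons t y))) by [].
by apply/funext => s; rewrite /g /= -row_cons_shift0 /GRing.scale/= mulr1.
Qed.

Lemma row_cons_derive0 n (f : 'rV[R]_n.+1 -> R) t y :
  derive1 (fun s => f (row_cons s y)) t = partial ord0 f (row_cons t y).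
Proof.
rewrite derive1E /partial /derive; set g := (X in lim (X @ _)).
suff -> : g = (fun h : R => h^-1 *: ((f \o shift (row_cons t y))
  (h *: delta_mx ord0 ord0) - f (row_cons t y))) by [].
by apply/funext => s; rewrite /g /= -row_cons_shift0 /GRing.scale/= mulr1.
Qed.

Lemma row_cons_derivable n (f : 'rV[R]_n.+1 -> R) (j : 'I_n) t y :
  derivable f (row_cons t y) (delta_mx ord0 (lift ord0 j)) ->
  derivable (fun z => f (row_cons t z)) y (delta_mx ord0 j).
Proof.
rewrite /derivable => h; set g := (X in cvg (X @ _)).
suff -> : g = (fun h : R => h^-1 *: ((f \o shift (row_cons t y))
  (h *: delta_mx ord0 (lift ord0 j)) - f (row_cons t y))) by [].
by apply/funext => s; rewrite /g /= row_cons_shift.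
Qed.

Lemma row_cons_derive n (f : 'rV[R]_n.+1 -> R) (j : 'I_n) t y :
  partial j (fun z => f (row_cons t z)) y =
  partial (lift ord0 j) f (row_cons t y).
Proof.
rewrite /partial /derive; set g := (X in lim (X @ _)).
suff -> : g = (fun h : R => h^-1 *: ((f \o shift (row_cons t y))
  (h *: delta_mx ord0 (lift ord0 j)) - f (row_cons t y))) by [].
by apply/funext => s; rewrite /g /= row_cons_shift.
Qed.

Lemma integral_derive1_compact (F f : R -> R) r : 0 < r -> continuous f ->
  (forall t, derivable F t 1) -> (forall t, derive1 F t = f t) ->
  (forall t, r < `|t| -> F t = 0 /\ f t = 0) ->
  (\int[lebesgue_measure]_t (f t)%:E = 0)%E.
Proof.
move=> r0 cf dF F'f Fr.
have cF : continuous F.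
  by move=> t; apply: differentiable_continuous; exact/derivable1_diffP.
have fE : (EFin \o f) = (EFin \o f) \_ `[- (r + 1), r + 1]%classic.
  apply/funext => t; rewrite patchE; case: ifPn => //.
  rewrite notin_setE /= in_itv /= -ler_norml => /negP; rewrite -ltNge => rt.
  by rewrite (Fr t _).2//; lra.
rewrite -[LHS]/(\int[lebesgue_measure]_t (EFin \o f) t)%E fE -integral_mkcond.
rewrite (@continuous_FTC2 _ f F)//; first last.
- split => //; first exact/cvg_at_right_filter/cF.
  exact/cvg_at_left_filter/cF.
- exact: continuous_subspaceT.
- lra.
rewrite (Fr (r + 1) _).1 ?(Fr (- (r + 1)) _).1 ?subee//.
  by rewrite normrN ger0_norm; lra.
by rewrite ger0_norm; lra.
Qed.

(** By induction on the dimension, following the construction of [leb]. Fubini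
    isolates the first coordinate: for j = 0 the inner integral is the
    fundamental theorem of calculus on a long segment, and otherwise the slice
    is an instance in one dimension less. Only derivability in direction j is
    assumed, because that is what slices inherit directly. *)
Lemma integral_partial n (j : 'I_n) (f : 'rV[R]_n -> R) :
  (forall x, derivable f x (delta_mx ord0 j)) ->
  continuous (partial j f) -> bounded_support f ->
  (\int[leb n]_x (partial j f x)%:E = 0)%E.
Proof.
elim: n => [|n IHn] in j f *; first by case: j.
move=> df cf [r fr].
have bp : bounded_support (partial j f) by exists r; exact: partial_bounded_support.
have ip := continuous_integrable_rV measurableT cf bp.
have mcons : measurable_fun setT (@rV_cons R n) by exact: measurable_rV_cons.
have mp : measurable_fun setT (EFin \o partial j f).
  by apply/measurable_EFinP; exact: continuous_measurable_rV.
have ip' : (@lebesgue_measure R \x leb n)%E.-integrable setT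
    ((EFin \o partial j f) \o @rV_cons R n).
  apply/integrableP; split; first exact: measurableT_comp.
  move/integrableP : ip => [_]; rewrite /= /rV_cons_measure.
  rewrite (@ge0_integral_pushforward _ _ _ _ _ _ mcons
    (@lebesgue_measure R \x leb n)%E setT
    (abse \o (EFin \o partial j f))%E) //; first exact: measurableT_comp.
  by move=> x _; exact: abse_ge0.
rewrite /= /rV_cons_measure (integral_pushforward _ mp)//.
rewrite preimage_setT.
have [k|] := unliftP ord0 j; move=> jE; subst j.
  rewrite -integral12_prod_meas1// integral0_eq// => t _ /=.
  rewrite /fubini_F /=; under eq_integral do rewrite -/(row_cons _ _) -row_cons_derive.
  apply: IHn.
  - by move=> y; apply: row_cons_derivable; exact: df.
  - rewrite (_ : partial k _ = partial (lift ord0 k) f \o row_cons t).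
      by move=> y; apply: continuous_comp; [exact: row_cons_continuous|exact: cf].
    by apply/funext => y; rewrite row_cons_derive.
  - by exists r => y ry; apply: fr; exact: lt_le_trans (row_cons_norm _ _).
rewrite -integral21_prod_meas1// integral0_eq// => y _ /=. rewrite /fubini_G /=.
apply: (@integral_derive1_compact (fun t => f (row_cons t y)) _ (Num.max r 1)).
- by rewrite lt_max ltr01 orbT.
- move=> t; apply: (@continuous_comp _ _ _ (fun t => row_cons t y) (partial ord0 f)).
    exact: row_cons_continuousl.
  exact: cf.
- by move=> t; apply: row_cons_derivable0; exact: df.
- by move=> t; exact: row_cons_derive0.
- move=> t rt; have rt' : r < `|row_cons t y|.
    apply: lt_le_trans (row_cons_norm0 t y).
    by move: rt; rewrite gt_max => /andP[].
  by split; [exact: fr|exact: partial_bounded_support fr _ rt'].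
Qed.

End divergence.

(** * Closure properties of smooth functions *)

Section smooth_functions.
Context {R : realType} {d : nat}.
Implicit Types (f g : 'rV[R]_d -> R) (S : ('rV[R]_d -> R) -> Prop).

(** Smoothness is stable under any choice of differentiable functions that is
    closed under partial derivatives; it is proved by exhibiting such a class. *)
Lemma smooth_coind S :
  (forall f, S f -> (forall x, differentiable f x) /\
                    forall j, S (partial j f)) ->
  forall f, S f -> smooth f.
Proof.
move=> HS f Sf s x.
have /HS[] // : S (foldr (@partial R d) f s).
by elim: s => [//|j s /HS[_]]; exact.
Qed.

Lemma smooth_differentiable f x : smooth f -> differentiable f x.
Proof. by move=> /(_ [::]); exact. Qed.

Lemma smooth_partial f j : smooth f -> smooth (partial j f).
Proof. by move=> sf s x; have := sf (rcons s j) x; rewrite foldr_rcons. Qed.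

Lemma smooth_derivable f x v : smooth f -> derivable f x v.
Proof. by move=> sf; apply: diff_derivable; exact: smooth_differentiable. Qed.

Lemma smooth_continuous f : smooth f -> continuous f.
Proof.
by move=> sf x; apply: differentiable_continuous; exact: smooth_differentiable.
Qed.

(** The class used with [smooth_coind]: by the product rule, it is closed under
    partial derivatives as soon as its generators have theirs in it. *)
Inductive algebra S : ('rV[R]_d -> R) -> Prop :=
| algebra_gen f : S f -> algebra S f
| algebra_cst c : algebra S (cst c)
| algebraD f g : algebra S f -> algebra S g -> algebra S (f + g)
| algebraM f g : algebra S f -> algebra S g -> algebra S (f * g).

Lemma partial_cst c j : partial j (cst c : 'rV[R]_d -> R) = cst 0.
Proof. by apply/funext => x; rewrite /partial derive_cst. Qed.

Lemma partialD f g j : (forall x, differentiable f x) ->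
  (forall x, differentiable g x) ->
  partial j (f + g) = partial j f + partial j g.
Proof.
move=> df dg; apply/funext => x; rewrite /partial deriveD//;
exact: diff_derivable.
Qed.

Lemma partialM f g j : (forall x, differentiable f x) ->
  (forall x, differentiable g x) ->
  partial j (f * g) = f * partial j g + g * partial j f.
Proof.
move=> df dg; apply/funext => x; rewrite /partial deriveM//;
exact: diff_derivable.
Qed.

Lemma algebra_smooth S :
  (forall f, S f -> (forall x, differentiable f x) /\
                    forall j, algebra S (partial j f)) ->
  forall f, algebra S f -> smooth f.
Proof.
move=> HS; apply: smooth_coind => f.
elim=> {f} [f /HS//|c|f g _ [df af] _ [dg ag]|f g Af [df af] Ag [dg ag]].
- by split=> // j; rewrite partial_cst; exact: algebra_cst.
- split=> [x|j]; first exact: differentiableD.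
  by rewrite partialD//; exact: algebraD.
- split=> [x|j]; first exact: differentiableM.
  by rewrite partialM//; apply: algebraD; exact: algebraM.
Qed.

Lemma algebra_of_smooth f : algebra (@smooth R d) f -> smooth f.
Proof.
apply: algebra_smooth => {}f sf; split=> [x|j]; first exact: smooth_differentiable.
by apply: algebra_gen; exact: smooth_partial.
Qed.

Lemma smooth_cst c : smooth (cst c : 'rV[R]_d -> R).
Proof. by apply: algebra_of_smooth; exact: algebra_cst. Qed.

Lemma smoothD f g : smooth f -> smooth g -> smooth (f + g).
Proof.
by move=> sf sg; apply: algebra_of_smooth; apply: algebraD; exact: algebra_gen.
Qed.

Lemma smoothM f g : smooth f -> smooth g -> smooth (f * g).
Proof.
by move=> sf sg; apply: algebra_of_smooth; apply: algebraM; exact: algebra_gen.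
Qed.

End smooth_functions.

(** * Smooth bumps supported in boxes *)

Section exp_step.
Context {R : realType}.

(** With m = 0, the classical smooth function exp(-1/t) of t > 0. The powers of
    1/t are there to make the family closed under derivation. *)
Definition exp_step (m : nat) (t : R) : R :=
  if 0 < t then t^-1 ^+ m * expR (- t^-1) else 0.

Lemma exp_step_ge0 m t : 0 <= exp_step m t.
Proof.
rewrite /exp_step; case: ifP => // t0.
by rewrite mulr_ge0 ?expR_ge0// exprn_ge0// invr_ge0 ltW.
Qed.

(** The term of order m + 2 in the series of exp(1/t) beats the power of 1/t;
    two orders to spare yield a zero derivative at the origin. *)
Lemma exp_step_le m t : exp_step m t <= m.+2`!%:R * t ^+ 2.
Proof.
rewrite /exp_step; case: ifPn => [t0|_]; last by rewrite mulr_ge0 ?sqr_ge0.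
rewrite expRN ler_pdivrMr ?expR_gt0//.
have s0 : 0 <= t^-1 by rewrite invr_ge0 ltW.
have := expR_ge1Dxn m.+1 s0.
set e := expR _ => he.
have f0 : 0 < m.+2`!%:R :> R by rewrite ltr0n fact_gt0.
have : t^-1 ^+ m.+2 <= m.+2`!%:R * e.
  by rewrite mulrC -ler_pdivrMr//; lra.
move=> h; apply: (@le_trans _ _ (t ^+ 2 * (t^-1 ^+ m.+2))).
  rewrite le_eqVlt; apply/orP; left; apply/eqP; rewrite (exprS _ m.+1) (exprS _ m).
  by set y := t^-1 ^+ m; field; rewrite gt_eqF.
by rewrite [leRHS]mulrAC mulrC ler_wpM2r// sqr_ge0.
Qed.

Lemma exp_step_le1 t : exp_step 0 t <= 1.
Proof.
rewrite /exp_step; case: ifP => // t0; rewrite expr0 mul1r.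
by rewrite -[leRHS]expR0 ler_expR oppr_le0 invr_ge0 ltW.
Qed.

Lemma is_derive_exp_step m (t : R) :
  is_derive t 1 (exp_step m) (exp_step m.+2 t - m%:R * exp_step m.+1 t).
Proof.
have [t0|t0|->] := ltgtP t 0.
- have z k : exp_step k t = 0 by rewrite /exp_step lt_gtF.
  rewrite !z mulr0 subr0.
  apply: (@near_eq_is_derive R R R (cst 0) _ t 1 0).
  near=> s; rewrite /exp_step lt_gtF//.
  by near: s; exact: lt_nbhsl.
- have t0' : t != 0 by rewrite gt_eqF.
  have dV : is_derive t 1 (fun s : R => s^-1) (- t ^- 2).
    apply: DeriveDef; first exact: derivableV.
    by rewrite deriveV// derive_id /GRing.scale/= mulr1.
  have dN : is_derive t 1 (fun s : R => - s^-1) (t ^- 2).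
    by rewrite -[t ^- 2]opprK; exact: is_deriveN.
  have dE : is_derive t 1 (fun s : R => expR (- s^-1)) (expR (- t^-1) * t ^- 2).
    exact: (@is_derive1_comp R expR (fun s => - s^-1) t _ _ (is_derive_expR _) dN).
  have dX := is_deriveX m dV.
  have near_g : \near t, t^-1 ^+ m * expR (- t^-1) = exp_step m t.
    near=> s; rewrite /exp_step ifT//.
    by near: s; exact: lt_nbhsr.
  apply: (near_eq_is_derive near_g).
  have dM := is_deriveM dX dE.
  rewrite (_ : (fun s => _) =
    (GRing.inv : R -> R) ^+ m * (fun s : R => expR (- s^-1))); last first.
    by apply/funext => s; rewrite !fctE.
  apply: (is_derive_eq dM); rewrite !fctE /exp_step t0 {near_g dM dX dE dN dV}.
  rewrite /GRing.scale/=; case: m => [|m] /=.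
    by rewrite !expr0; set e := expR _; field.
  by rewrite !exprS; set y := t^-1 ^+ m; set e := expR _; field.
- have e0 k : exp_step k 0 = 0 by rewrite /exp_step ltxx.
  rewrite !e0 mulr0 subr0.
  suff h0 : h^-1 *: ((exp_step m \o shift 0) (h *: 1) - exp_step m 0)
      @[h --> (0 : R)^'] --> (0 : R).
    by apply: DeriveDef; [apply/cvg_ex; exists 0|exact: cvg_lim h0].
  pose K : R := m.+2`!%:R + 1.
  have K0 : 0 < K by rewrite /K ltr_wpDl.
  apply/cvgrPdist_le => e e0'; near=> h.
  rewrite /= e0 subr0 addr0 sub0r normrN /GRing.scale/= mulr1 normrM normfV.
  have hn0 : h != 0 by near: h; exact: nbhs_dnbhs_neq.
  rewrite ler_pdivrMl ?normr_gt0// (ger0_norm (exp_step_ge0 _ _)).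
  apply: (le_trans (exp_step_le _ _)).
  rewrite -real_normK ?num_real// expr2 mulrCA ler_wpM2l//.
  apply: (@le_trans _ _ (K * `|h|)); first by rewrite ler_wpM2r// /K lerDl.
  rewrite -ler_pdivlMl//.
  near: h; apply: dnbhs0_le; by rewrite mulr_gt0// invr_gt0.
Unshelve. all: by end_near. Qed.

End exp_step.

Section bump.
Context {R : realType} {d : nat}.
Implicit Types (f g : 'rV[R]_d -> R) (a b : 'rV[R]_d).

Definition exp_ridge f := exists m (c e : R) (i : 'I_d),
  f = (fun x => exp_step m (c * x ord0 i + e)).

Lemma exp_ridge_partial m (c e : R) (i j : 'I_d) :
  let f := fun x : 'rV[R]_d => exp_step m (c * x ord0 i + e) in
  (forall x, differentiable f x) /\
  partial j f = (fun x => (c * (i == j)%:R) *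
    (exp_step m.+2 (c * x ord0 i + e) - m%:R * exp_step m.+1 (c * x ord0 i + e))).
Proof.
move=> f; pose L := (c \*: (fun x : 'rV[R]_d => x ord0 i : R)) + cst e.
have dL x : differentiable L x.
  by apply: differentiableD => //; apply: differentiableZ; exact: differentiable_coord.
have fE : f = exp_step m \o L by [].
have dG t : differentiable (exp_step m) t.
  by apply/derivable1_diffP; have [] := is_derive_exp_step m t.
have dv x : 'D_(delta_mx ord0 j) L x = c * (i == j)%:R.
  have dcL : derivable (c \*: (fun x : 'rV[R]_d => x ord0 i : R)) x (delta_mx ord0 j).
    by apply: diff_derivable; apply: differentiableZ; exact: differentiable_coord.
  rewrite (deriveD dcL (derivable_cst _ _ _)).
  rewrite derive_cst addr0 deriveZ; last exact/diff_derivable/differentiable_coord.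
  have := @derive_mx R _ 1 d (@id 'rV[R]_d) x (delta_mx ord0 j) (@derivable_id _ _ x _).
  move=> /matrixP/(_ ord0 i); rewrite derive_id !mxE eqxx/= => <-.
  by rewrite eq_sym.
split=> [x|]; first by rewrite fE; apply: differentiable_comp => //.
apply/funext => x; rewrite /partial deriveE; last first.
  by rewrite fE; apply: differentiable_comp => //.
rewrite fE diff_comp//= -(deriveE _ (dL x)) dv.
rewrite diff1E//= derive1E; have [_ ->] := is_derive_exp_step m (L x).
by [].
Qed.

Lemma algebra_prod S (I : Type) (r : seq I) (F : I -> 'rV[R]_d -> R) :
  (forall i, algebra S (F i)) -> algebra S (fun x => \prod_(i <- r) F i x).
Proof.
move=> SF; elim: r => [|i r IH].
  by under eq_fun do rewrite big_nil; exact: algebra_cst.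
under eq_fun do rewrite big_cons.
exact: (algebraM (SF i) IH).
Qed.

Lemma exp_ridge_smooth f : algebra exp_ridge f -> smooth f.
Proof.
apply: algebra_smooth => _ [m [c [e [i ->]]]].
split=> [x|j]; first by have [] := exp_ridge_partial m c e i i.
have [_ ->] := exp_ridge_partial m c e i j.
apply: (algebraM (algebra_cst _ _)).
apply: (@algebraD _ _ _ (fun x : 'rV[R]_d => exp_step m.+2 (c * x ord0 i + e))
  (- (fun x : 'rV[R]_d => m%:R * exp_step m.+1 (c * x ord0 i + e)))).
  by apply: algebra_gen; exists m.+2, c, e, i.
rewrite [X in algebra _ X](_ : _ =
    cst (- m%:R) * (fun x : 'rV[R]_d => exp_step m.+1 (c * x ord0 i + e))); last first.
  by apply/funext => x; rewrite !fctE mulNr.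
apply: (algebraM (algebra_cst _ _)).
by apply: algebra_gen; exists m.+1, c, e, i.
Qed.

(** Scaling the argument by n makes exp(-1/(n t)) increase to the indicator of
    t > 0, so that one formula gives smooth functions, bounded by 1 and
    vanishing outside the box, that converge to its indicator. *)
Definition box_bump a b (n : nat) (x : 'rV[R]_d) : R :=
  \prod_i (exp_step 0 (n%:R * x ord0 i + - n%:R * a ord0 i) *
           exp_step 0 (- n%:R * x ord0 i + n%:R * b ord0 i)).

Lemma box_bump_smooth a b n : smooth (box_bump a b n).
Proof.
apply: exp_ridge_smooth; apply: algebra_prod => i.
apply: algebraM; apply: algebra_gen.
  by exists 0%N, n%:R, (- n%:R * a ord0 i), i.
by exists 0%N, (- n%:R), (n%:R * b ord0 i), i.
Qed.

Lemma box_bump_itv a b n x : 0 <= box_bump a b n x <= 1.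
Proof.
rewrite /box_bump; elim/big_ind: _ => [|y z /andP[y0 y1] /andP[z0 z1]|i _].
- by rewrite ler01 lexx.
- by rewrite mulr_ge0//= mulr_ile1.
- by rewrite mulr_ge0 ?exp_step_ge0//= mulr_ile1 ?exp_step_ge0 ?exp_step_le1.
Qed.

Lemma box_bump_out a b n x : ~ obox a b x -> box_bump a b n x = 0.
Proof.
move=> /existsNP[i /negP]; rewrite negb_and -!leNgt => h.
rewrite /box_bump (bigD1 i)//= /exp_step.
case/orP: h => h.
  rewrite [X in X * _ * _]ifF ?mul0r//; apply/negbTE; rewrite -leNgt.
  by rewrite mulNr -mulrBr mulr_ge0_le0// subr_le0.
rewrite [X in _ * X * _]ifF ?mulr0 ?mul0r//; apply/negbTE; rewrite -leNgt.
by rewrite mulNr addrC -mulrBr mulr_ge0_le0// subr_le0.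
Qed.

Lemma exp_step_cvg1 t : 0 < t -> exp_step 0 (n%:R * t) @[n --> \oo] --> (1 : R).
Proof.
move=> t0; have h : expR (- (t^-1 * n.+1%:R^-1)) @[n --> \oo] --> expR (- (t^-1 * 0)).
  apply: continuous_cvg; first exact: continuous_expR.
  by apply: cvgN; apply: cvgM; [exact: cvg_cst|exact: cvg_harmonic].
move: h; rewrite mulr0 oppr0 expR0 => h.
rewrite -(cvg_shiftS (fun n => exp_step 0 (n%:R * t))) /=.
apply: cvg_trans h; apply: near_eq_cvg; near=> n.
by rewrite /exp_step mulr_gt0// expr0 mul1r invfM mulrC.
Unshelve. all: by end_near. Qed.

Lemma box_bump_cvg a b x : obox a b x -> box_bump a b n x @[n --> \oo] --> (1 : R).
Proof.
move=> xab; rewrite /box_bump.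
elim: (index_enum _) => [|i r IH].
  by under eq_fun do rewrite big_nil; exact: cvg_cst.
under eq_fun do rewrite big_cons.
have /andP[ax xb] := xab i.
have h1 : exp_step 0 (n%:R * x ord0 i + - n%:R * a ord0 i) @[n --> \oo] --> (1 : R).
  under eq_fun do rewrite mulNr -mulrBr.
  by apply: exp_step_cvg1; rewrite subr_gt0.
have h2 : exp_step 0 (- n%:R * x ord0 i + n%:R * b ord0 i) @[n --> \oo] --> (1 : R).
  under eq_fun do rewrite mulNr addrC -mulrBr.
  by apply: exp_step_cvg1; rewrite subr_gt0.
have := cvgM (cvgM h1 h2) IH; rewrite !mulr1; exact.
Qed.

Lemma compact_cbox a b : compact (cbox a b).
Proof.
by apply: (@rV_compact _ _ (fun i => `[a ord0 i, b ord0 i]%classic)) => i;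
  exact: segment_compact.
Qed.

Lemma box_bump_test (Omega : set 'rV[R]_d) a b n :
  cbox a b `<=` Omega -> test_fun Omega (box_bump a b n).
Proof.
move=> abO; split; first exact: box_bump_smooth.
exists (cbox a b); split=> //; first exact: compact_cbox.
by move=> x xab; apply: box_bump_out => /obox_cbox.
Qed.

End bump.

(** * Square-integrable functions *)

Section square_integrable.
Context {R : realType} {d : nat} {Omega : set 'rV[R]_d}.
Context (mO : measurable Omega).
Implicit Types (f g h : 'rV[R]_d -> R).

Lemma L2_integrableM f g : L2 Omega f -> L2 Omega g ->
  (leb d).-integrable Omega (fun x => (f x * g x)%:E).
Proof.
move=> [mf f2] [mg g2].
apply: (le_integrable mO _ _ (integrableD mO f2 g2)).
  by apply/measurable_EFinP; exact: measurable_funM.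
move=> x _ /=; rewrite lee_fin [leRHS]ger0_norm ?addr_ge0 ?sqr_ge0//.
have := sqr_ge0 (f x + g x); have := sqr_ge0 (f x - g x).
by rewrite ler_norml => *; apply/andP; split; nra.
Qed.

Lemma L2_measurable f : L2 Omega f -> measurable_fun Omega f.
Proof. by case. Qed.

Lemma L2D f g : L2 Omega f -> L2 Omega g -> L2 Omega (f + g).
Proof.
move=> Lf Lg; have [mf f2] := Lf; have [mg g2] := Lg.
split; first exact: measurable_funD.
have h := integrableD mO (integrableD mO f2 g2)
  (integrableZl mO 2 (L2_integrableM Lf Lg)).
apply: eq_integrable h => // x _ /=.
by rewrite !fctE -EFinM -!EFinD; congr EFin; ring.
Qed.

Lemma L2Z (c : R) f : L2 Omega f -> L2 Omega (c *: f).
Proof.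
move=> [mf f2]; split.
  by apply: measurable_funM => //; exact: measurable_cst.
apply: eq_integrable (integrableZl mO (c ^+ 2) f2) => // x _ /=.
by rewrite -EFinM -exprMn.
Qed.

Lemma L2N f : L2 Omega f -> L2 Omega (- f).
Proof. by move=> /(L2Z (-1)); rewrite scaleN1r. Qed.

Lemma L2B f g : L2 Omega f -> L2 Omega g -> L2 Omega (f - g).
Proof. by move=> Lf /L2N; exact: L2D. Qed.

Lemma L2_0 : L2 Omega (0 : 'rV[R]_d -> R).
Proof.
split; first exact: measurable_cst.
by apply: eq_integrable (integrable0 _ _) => // x _ /=; rewrite expr0n.
Qed.

Lemma L2_sum I (s : seq I) (F : I -> 'rV[R]_d -> R) :
  (forall i, L2 Omega (F i)) -> L2 Omega (fun x => \sum_(i <- s) F i x).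
Proof.
move=> LF; elim: s => [|i s IH].
  by under eq_fun do rewrite big_nil; exact: L2_0.
by under eq_fun do rewrite big_cons; exact: L2D.
Qed.

Definition ip f g : R := \int[leb d]_(x in Omega) (f x * g x).

Lemma ipC f g : ip f g = ip g f.
Proof. by apply: eq_Rintegral => x _; rewrite mulrC. Qed.

Lemma ipDl f1 f2 g : L2 Omega f1 -> L2 Omega f2 -> L2 Omega g ->
  ip (f1 + f2) g = ip f1 g + ip f2 g.
Proof.
move=> L1 L2' Lg; rewrite -RintegralD//; try exact: L2_integrableM.
by apply: eq_Rintegral => x _; rewrite !fctE mulrDl.
Qed.

Lemma ipZl (c : R) f g : L2 Omega f -> L2 Omega g ->
  ip (c *: f) g = c * ip f g.
Proof.
move=> Lf Lg; rewrite -RintegralZl//; try exact: L2_integrableM.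
by apply: eq_Rintegral => x _; rewrite mulrA.
Qed.

Lemma ipNl f g : L2 Omega f -> L2 Omega g -> ip (- f) g = - ip f g.
Proof. by move=> Lf Lg; rewrite -scaleN1r ipZl// mulN1r. Qed.

Lemma ipBl f1 f2 g : L2 Omega f1 -> L2 Omega f2 -> L2 Omega g ->
  ip (f1 - f2) g = ip f1 g - ip f2 g.
Proof. by move=> L1 L2' Lg; rewrite ipDl ?ipNl//; exact: L2N. Qed.

Lemma ipBr f g1 g2 : L2 Omega f -> L2 Omega g1 -> L2 Omega g2 ->
  ip f (g1 - g2) = ip f g1 - ip f g2.
Proof. by move=> Lf L1 L2'; rewrite ipC ipBl// !(ipC f). Qed.

Lemma ip_ge0 f : 0 <= ip f f.
Proof. by apply: Rintegral_ge0 => x _; rewrite -expr2 sqr_ge0. Qed.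

(** The quadratic t |-> |f + t g|^2 is nonnegative. *)
Lemma cauchy_schwarz_ip f g : L2 Omega f -> L2 Omega g ->
  ip f g ^+ 2 <= ip f f * ip g g.
Proof.
move=> Lf Lg.
have H t : 0 <= ip f f + 2 * t * ip f g + t ^+ 2 * ip g g.
  have := ip_ge0 (f + t *: g); have Ltg := L2Z t Lg.
  have Lftg := L2D Lf Ltg.
  rewrite ipDl// ipZl// (ipC f (f + _)) (ipC g (f + _)) !ipDl// !ipZl// (ipC g f).
  by move/le_trans; apply; rewrite le_eqVlt; apply/orP; left; apply/eqP; ring.
have := ip_ge0 g; rewrite le_eqVlt => /orP[/eqP g0|g0].
  rewrite -g0 mulr0; suff -> : ip f g = 0 by rewrite expr0n.
  apply/eqP/negPn/negP => fg0.
  (* this value of t turns |f|^2 + 2 t (f, g) into -1 *)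
  have := H (- (ip f f + 1) / (2 * ip f g)); rewrite -g0.
  suff -> : ip f f + 2 * (- (ip f f + 1) / (2 * ip f g)) * ip f g +
    (- (ip f f + 1) / (2 * ip f g)) ^+ 2 * 0 = -1 by lra.
  by field.
have := H (- ip f g / ip g g).
rewrite -(pmulr_lge0 _ g0).
suff -> : (ip f f + 2 * (- ip f g / ip g g) * ip f g +
  (- ip f g / ip g g) ^+ 2 * ip g g) * ip g g =
  ip f f * ip g g - ip f g ^+ 2 by rewrite subr_ge0.
by field; rewrite gt_eqF.
Qed.

Lemma ae_eq_ipl f f' g : measurable_fun Omega f -> measurable_fun Omega f' ->
  measurable_fun Omega g ->
  {ae leb d, forall x, Omega x -> f x = f' x} -> ip f g = ip f' g.
Proof.
move=> mf mf' mg ff'; congr fine; apply: ae_eq_integral => //.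
- by apply/measurable_EFinP; exact: measurable_funM.
- by apply/measurable_EFinP; exact: measurable_funM.
- by apply: filterS ff' => x /= ff' Ox; rewrite ff'.
Qed.

Lemma ae0_ip0 f : measurable_fun Omega f ->
  {ae leb d, forall x, Omega x -> f x = 0} -> ip f f = 0.
Proof.
move=> mf f0; rewrite (@ae_eq_ipl f (cst 0) f)//.
rewrite /ip; under eq_Rintegral do rewrite mul0r.
by rewrite /Rintegral integral0.
Qed.

Lemma L2_subset A f : measurable A -> A `<=` Omega -> L2 Omega f -> L2 A f.
Proof.
move=> mA AO [mf f2]; split; first exact: measurable_funS mf.
exact: integrableS f2.
Qed.

Lemma L2_cst (c : R) : (leb d Omega < +oo)%E -> L2 Omega (cst c).
Proof.
move=> Ooo; split; first exact: measurable_cst.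
apply/integrableP; split; first exact: (@measurable_cst _ _ _ _ _ ((c ^+ 2)%:E)).
rewrite (eq_integral (cst (c ^+ 2)%:E)); last first.
  by move=> x _ /=; rewrite ger0_norm ?sqr_ge0.
by rewrite integral_cst// lte_mul_pinfty// lee_fin sqr_ge0.
Qed.

Lemma L2_integrable f : (leb d Omega < +oo)%E -> L2 Omega f ->
  (leb d).-integrable Omega (EFin \o f).
Proof.
move=> Ooo Lf; apply: eq_integrable (L2_integrableM Lf (L2_cst 1 Ooo)) => // x _.
by rewrite /= mulr1.
Qed.

Lemma continuous_L2 f : continuous f -> bounded_support f -> L2 Omega f.
Proof.
move=> cf [r fr]; split.
  by apply: measurable_funTS; exact: continuous_measurable_rV.
apply: (@continuous_integrable_rV _ _ _ (fun x => f x ^+ 2)) => //.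
  by move=> x; apply: continuousM => //; exact: cf.
by exists r => x /fr ->; rewrite expr0n.
Qed.

End square_integrable.
Arguments ip {R d} Omega f g.

(** * Test functions and their density *)

Section test_functions.
Context {R : realType} {d : nat} {Omega : set 'rV[R]_d}.
Context (oO : open Omega).
Implicit Types (f g h phi psi : 'rV[R]_d -> R) (a b : 'rV[R]_d).

Let mO : measurable Omega := open_measurable_rV oO.

Lemma test_fun_out phi x : test_fun Omega phi -> ~ Omega x -> phi x = 0.
Proof. by move=> [_ [K [_ KO K0]]] Ox; apply: K0 => /KO. Qed.

Lemma test_fun_bounded_support phi : test_fun Omega phi -> bounded_support phi.
Proof.
move=> [_ [K [cK _ K0]]]; have [M [_ HM]] := compact_bounded cK.
exists (`|M| + 1) => x Mx; apply: K0 => Kx; move: Mx; apply/negP; rewrite -leNgt.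
by apply: (HM (`|M| + 1)) => //; rewrite (le_lt_trans (ler_norm _))// ltrDl.
Qed.

Lemma test_fun_smooth phi : test_fun Omega phi -> smooth phi.
Proof. by case. Qed.

Lemma test_fun_L2 phi : test_fun Omega phi -> L2 Omega phi.
Proof.
move=> tphi; apply: continuous_L2 => //; last exact: test_fun_bounded_support.
exact/smooth_continuous/test_fun_smooth.
Qed.

Lemma test_fun_partial j phi : test_fun Omega phi -> test_fun Omega (partial j phi).
Proof.
move=> [sphi [K [cK KO K0]]]; split; first exact: smooth_partial.
exists K; split=> // x Kx; rewrite /partial -(derive_cst (0 : R) x (delta_mx ord0 j)).
apply: near_eq_derive.
have /open_nbhs_nbhs : open_nbhs x (~` K).
  split=> //; apply: closed_openC; apply: compact_closed => //.
by apply: filterS => y; exact: K0.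
Qed.

Lemma test_funM phi g : test_fun Omega phi -> smooth g ->
  test_fun Omega (phi * g).
Proof.
move=> [sphi [K [cK KO K0]]] sg; split; first exact: smoothM.
by exists K; split=> // x Kx; rewrite fctE K0// mul0r.
Qed.

Lemma test_funZ (c : R) phi : test_fun Omega phi -> test_fun Omega (c *: phi).
Proof.
move=> tphi; have := test_funM tphi (smooth_cst c).
by congr test_fun; apply/funext => x; rewrite !fctE mulrC.
Qed.

Lemma test_funD phi psi : test_fun Omega phi -> test_fun Omega psi ->
  test_fun Omega (phi + psi).
Proof.
move=> [sphi [K [cK KO K0]]] [spsi [L [cL LO L0]]]; split; first exact: smoothD.
exists (K `|` L); split; first exact: compactU.
  by move=> x [/KO|/LO].
by move=> x /not_orP[Kx Lx]; rewrite fctE K0// L0// addr0.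
Qed.

Lemma test_fun0 : test_fun Omega (0 : 'rV[R]_d -> R).
Proof.
split; first exact: smooth_cst.
by exists set0; split=> //; exact: compact0.
Qed.

Lemma test_fun_sum I (s : seq I) (F : I -> 'rV[R]_d -> R) :
  (forall i, test_fun Omega (F i)) -> test_fun Omega (fun x => \sum_(i <- s) F i x).
Proof.
move=> tF; elim: s => [|i s IH].
  by under eq_fun do rewrite big_nil; exact: test_fun0.
by under eq_fun do rewrite big_cons; exact: test_funD.
Qed.

Lemma test_fun_integrable phi : test_fun Omega phi ->
  (leb d).-integrable Omega (EFin \o phi).
Proof.
move=> tphi; apply: continuous_integrable_rV => //.
  exact/smooth_continuous/test_fun_smooth.
exact: test_fun_bounded_support.
Qed.

(** A test function vanishes outside Omega, hence the integral over Omega is an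
    integral over the whole space. *)
Lemma integral_test_fun_partial j phi : test_fun Omega phi ->
  \int[leb d]_(x in Omega) partial j phi x = 0.
Proof.
move=> tphi; have tj := test_fun_partial j tphi.
rewrite Rintegral_mkcond (_ : _ \_ Omega = partial j phi); last first.
  apply/funext => x; rewrite patchE; case: ifPn => //.
  by rewrite notin_setE => /(test_fun_out tj) ->.
rewrite /Rintegral integral_partial//.
- by move=> x; apply/smooth_derivable/test_fun_smooth.
- exact/smooth_continuous/test_fun_smooth.
- exact: test_fun_bounded_support.
Qed.

(** Integration by parts is the vanishing of the integral of the derivative of
    phi psi. *)
Lemma test_fun_weak_partial j phi : test_fun Omega phi ->
  weak_partial Omega j phi (partial j phi).
Proof.
move=> tphi psi tpsi; apply/eqP; rewrite -addr_eq0; apply/eqP.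
have tj := test_fun_partial j tphi; have tjp := test_fun_partial j tpsi.
rewrite -RintegralD//; try by apply: L2_integrableM => //; exact: test_fun_L2.
rewrite -[RHS](integral_test_fun_partial j (test_funM tphi (test_fun_smooth tpsi))).
apply: eq_Rintegral => x _; rewrite partialM//; last 2 first.
- by move=> y; apply/smooth_differentiable/test_fun_smooth.
- by move=> y; apply/smooth_differentiable/test_fun_smooth.
by rewrite !fctE; congr (_ + _); exact: mulrC.
Qed.

(** Dominated convergence along the bumps of the box, on which |h| is
    integrable since the box has finite measure. *)
Lemma integral_box_eq0 h a b : L2 Omega h ->
  (forall phi, test_fun Omega phi -> ip Omega h phi = 0) ->
  cbox a b `<=` Omega -> (\int[leb d]_(x in obox a b) (h x)%:E = 0)%E.
Proof.
move=> Lh h0 abO.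
have mC := measurable_cbox a b.
have LC := L2_subset mO mC abO Lh.
have iC := L2_integrable mC (leb_cbox_fin a b) LC.
have mhC : measurable_fun (cbox a b) h by case: LC.
pose F n x := (h x * box_bump a b n x)%:E.
have F0 n : (\int[leb d]_(x in cbox a b) F n x = 0)%E.
  have := h0 _ (box_bump_test n abO); rewrite /ip /Rintegral => /eqP.
  rewrite fine_eq0; last first.
    apply: (integrable_fin_num mO); apply: L2_integrableM => //.
    exact/test_fun_L2/box_bump_test.
  move=> /eqP; rewrite integral_mkcond => h0'.
  rewrite integral_mkcond -[RHS]h0'; apply: eq_integral => x _.
  rewrite !patchE; case: ifPn => [xC|].
    by rewrite ifT//; apply/mem_set/abO; exact/set_mem.
  rewrite notin_setE => xC; case: ifP => // _.
  by rewrite box_bump_out ?mulr0// => /obox_cbox.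
have mF n : measurable_fun (cbox a b) (F n).
  apply/measurable_EFinP; apply: measurable_funM => //.
  apply: measurable_funTS; apply: continuous_measurable_rV.
  exact/smooth_continuous/box_bump_smooth.
have mob := measurable_obox a b.
have mf : measurable_fun (cbox a b) (fun x => (h x * \1_(obox a b) x)%:E).
  apply/measurable_EFinP; apply: measurable_funM => //.
have Ff : {ae leb d, forall x, cbox a b x ->
    F ^~ x @ \oo --> (h x * \1_(obox a b) x)%:E}.
  apply: aeW => x _; apply: cvg_EFin; first exact: nearW.
  apply: cvgM; first exact: cvg_cst.
  rewrite indicE; have [/set_mem xab|] := boolP (x \in obox a b).
    exact: box_bump_cvg.
  rewrite notin_setE => xab.
  under eq_fun do rewrite box_bump_out//; exact: cvg_cst.
have Fg : {ae leb d, forall x n, cbox a b x -> (`|F n x| <= (abse \o (EFin \o h)) x)%E}.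
  apply: aeW => x n _; rewrite /= lee_fin normrM ler_piMr//.
  by have /andP[? ?] := box_bump_itv a b n x; rewrite ger0_norm.
have [_ _] := dominated_convergence mC mF mf Ff (integrable_abse iC) Fg.
rewrite (_ : [sequence _]_n = cst 0%E); last by apply/funext.
move=> /cvg_unique -/(_ _ _ (cvg_cst _)) <-//.
rewrite [LHS]integral_mkcond [RHS]integral_mkcond; apply: eq_integral => x _.
rewrite !patchE indicE; case: ifPn => [xo|_].
  by rewrite ifT ?mulr1//; apply/mem_set/obox_cbox/set_mem.
by rewrite mulr0; case: ifP.
Qed.

Lemma obox_setI a1 b1 a2 b2 : obox a1 b1 `&` obox a2 b2 =
  obox (\row_i Num.max (a1 ord0 i) (a2 ord0 i))
       (\row_i Num.min (b1 ord0 i) (b2 ord0 i)) :> set 'rV[R]_d.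
Proof.
apply/seteqP; split=> [x [x1 x2] i|x x12].
  rewrite !mxE gt_max lt_min; have /andP[-> ->] := x1 i.
  by have /andP[-> ->] := x2 i.
by split=> i; have := x12 i; rewrite !mxE gt_max lt_min =>
  /andP[/andP[h1 h2] /andP[h3 h4]]; apply/andP; split.
Qed.

(** The sets A for which the integral vanishes form a Dynkin system that
    contains the boxes, which are stable under intersection. *)
Lemma integral_box_subset_eq0 h a b A : L2 Omega h ->
  (forall phi, test_fun Omega phi -> ip Omega h phi = 0) ->
  cbox a b `<=` Omega -> measurable A ->
  (\int[leb d]_(x in A `&` obox a b) (h x)%:E = 0)%E.
Proof.
move=> Lh h0 abO; have mB := measurable_obox a b.
have BO : obox a b `<=` Omega by move=> x /obox_cbox/abO.
have iB : (leb d).-integrable (obox a b) (EFin \o h).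
  apply: L2_integrable => //; last exact: L2_subset Lh.
  apply: le_lt_trans (leb_cbox_fin a b); apply: le_measure; rewrite ?inE//.
    exact: measurable_cbox.
  exact: obox_cbox.
have iS S : measurable S -> (leb d).-integrable (S `&` obox a b) (EFin \o h).
  move=> mS; apply: integrableS iB => //; exact: measurableI.
rewrite measurable_boxesE.
apply: (@dynkin_induction _ _ _ (fun S =>
  (\int[leb d]_(x in S `&` obox a b) (h x)%:E = 0)%E)) A => //.
- exact: measurable_boxesE.
- move=> _ _ [a1 [b1 ->]] [a2 [b2 ->]].
  rewrite obox_setI.
  by exists (\row_i Num.max (a1 ord0 i) (a2 ord0 i)),
    (\row_i Num.min (b1 ord0 i) (b2 ord0 i)).
- by rewrite setTI; exact: integral_box_eq0.
- move=> _ [a1 [b1 ->]].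
  rewrite obox_setI; apply: integral_box_eq0 => // x x12; apply: abO => i.
  have := x12 i; rewrite !mxE ge_max le_min => /andP[/andP[_ h1] /andP[_ h2]].
  by rewrite h1.
- move=> S mS S0; have := integral_box_eq0 Lh h0 abO.
  rewrite -{1}(setTI (obox a b)) -(setUv S) setIUl integral_setU//.
  + by rewrite S0 add0e.
  + exact: measurableI.
  + by apply: measurableI => //; exact: measurableC.
  + rewrite -setIUl setUv setTI; exact: measurable_int iB.
  + by apply/disj_setPS => x [[Sx _] [nSx _]]; exact: nSx.
- move=> F mF tF F0; rewrite setI_bigcupl integral_bigcup.
  + by rewrite eseries0.
  + exact: trivIset_setIr.
  + by move=> k; exact: measurableI.
  + rewrite -setI_bigcupl; apply: iS; exact: bigcupT_measurable.
Qed.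

(** The integral of h vanishes on every measurable part of a box in Omega, so h
    is zero almost everywhere there, and countably many boxes cover Omega. *)
Lemma test_fun_dense h : L2 Omega h ->
  (forall phi, test_fun Omega phi -> ip Omega h phi = 0) ->
  {ae leb d, forall x, Omega x -> h x = 0}.
Proof.
move=> Lh h0.
pose box (p : 'rV[rat]_d * 'rV[rat]_d) := obox (rat_row p.1 : 'rV[R]_d) (rat_row p.2).
pose good p := `[< cbox (rat_row p.1 : 'rV[R]_d) (rat_row p.2) `<=` Omega >].
pose N k := if unpickle k is Some p then
  (if good p then ~` [set x | box p x -> h x = 0] else set0) else set0.
have : (leb d).-negligible (\bigcup_k N k).
  apply: negligible_bigcup => k; rewrite /N.
  case: unpickle => [p|]; last exact: negligible_set0.
  rewrite /good; case: asboolP => pO; last exact: negligible_set0.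
  have mB := measurable_obox (rat_row p.1 : 'rV[R]_d) (rat_row p.2).
  have iB : (leb d).-integrable (box p) (EFin \o h).
    apply: L2_integrable => //.
      apply: le_lt_trans (leb_cbox_fin (rat_row p.1) (rat_row p.2)).
      apply: le_measure; rewrite ?inE//; first exact: measurable_cbox.
      exact: obox_cbox.
    by apply: L2_subset Lh => // x /obox_cbox/pO.
  have : ae_eq (leb d) (box p) (EFin \o h) (cst 0%E).
    apply: integral_ae_eq => // E EB mE.
    rewrite integral0 -(setIidl EB); exact: integral_box_subset_eq0.
  by apply: filterS => x /= hx /hx[].
apply: negligibleS => x /= /not_implyP[Ox hx0].
have [p [px pO]] := open_rat_box oO Ox.
exists (pickle p) => //; rewrite /N pickleK /good (asboolT pO).
by apply/not_implyP.
Qed.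

End test_functions.

(** * Weak derivatives *)

Lemma eq_cvgn (R : realType) (F G : nat -> R) (l : R) : F =1 G ->
  F n @[n --> \oo] --> l -> G n @[n --> \oo] --> l.
Proof. by move=> /funext ->. Qed.

Section sobolev.
Context {R : realType} {d : nat} {Omega : set 'rV[R]_d}.
Context (oO : open Omega).
Implicit Types (f g h phi psi : 'rV[R]_d -> R) (u v w : 'rV[R]_d -> 'rV[R]_d).

Let mO : measurable Omega := open_measurable_rV oO.

(** The difference of two weak derivatives is orthogonal to test functions. *)
Lemma weak_partial_unique j f g g' : L2 Omega g -> L2 Omega g' ->
  weak_partial Omega j f g -> weak_partial Omega j f g' ->
  {ae leb d, forall x, Omega x -> g x = g' x}.
Proof.
move=> Lg Lg' fg fg'.
have : {ae leb d, forall x, Omega x -> (g - g') x = 0}.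
  apply: (test_fun_dense oO); first exact: L2B.
  move=> phi tphi; have Lphi := test_fun_L2 oO tphi.
  rewrite ipBl//; apply/eqP; rewrite subr_eq0 -eqr_opp; apply/eqP.
  by have := fg _ tphi; rewrite (fg' _ tphi) => ->.
by apply: filterS => x h Ox; apply/eqP; rewrite -subr_eq0; apply/eqP/h.
Qed.

Lemma wderivP j f : H1space Omega f ->
  L2 Omega (wderiv Omega j f) /\ weak_partial Omega j f (wderiv Omega j f).
Proof.
move=> [_ /(_ j)[g Lg fg]].
exact: (@xgetPex _ (cst 0) [set g | L2 Omega g /\ weak_partial Omega j f g]
  (ex_intro _ g (conj Lg fg))).
Qed.

Lemma L2_wderiv j f : H1space Omega f -> L2 Omega (wderiv Omega j f).
Proof. by move=> /(wderivP j)[]. Qed.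

Lemma ip_wderiv j f phi : H1space Omega f -> test_fun Omega phi ->
  ip Omega f (partial j phi) = - ip Omega (wderiv Omega j f) phi.
Proof. by move=> /(wderivP j)[_]; exact. Qed.

Lemma wderiv_ae j f g : H1space Omega f -> L2 Omega g ->
  weak_partial Omega j f g ->
  {ae leb d, forall x, Omega x -> wderiv Omega j f x = g x}.
Proof.
move=> Hf Lg fg; have [Lw fw] := wderivP j Hf.
exact: weak_partial_unique Lw Lg fw fg.
Qed.

Lemma weak_partial_lin j (a : R) f g : H1space Omega f -> H1space Omega g ->
  weak_partial Omega j (a *: f + g)
    (a *: wderiv Omega j f + wderiv Omega j g).
Proof.
move=> Hf Hg phi tphi; have [Lf _] := Hf; have [Lg _] := Hg.
have Lphi := test_fun_L2 oO tphi.
have Lj := test_fun_L2 oO (test_fun_partial j tphi).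
have Lwf := L2_wderiv j Hf; have Lwg := L2_wderiv j Hg.
rewrite -/(ip Omega (a *: f + g) (partial j phi)).
rewrite -/(ip Omega (a *: wderiv Omega j f + wderiv Omega j g) phi).
rewrite ipDl//; last exact: L2Z.
rewrite ipZl// ipDl//; last exact: L2Z.
by rewrite ipZl// !ip_wderiv// opprD mulrN.
Qed.

Lemma H1_lin (a : R) f g : H1space Omega f -> H1space Omega g ->
  H1space Omega (a *: f + g).
Proof.
move=> Hf Hg; have [Lf _] := Hf; have [Lg _] := Hg.
split; first by apply: L2D => //; exact: L2Z.
move=> j; exists (a *: wderiv Omega j f + wderiv Omega j g).
  by apply: L2D => //; first apply: L2Z => //; exact: L2_wderiv.
exact: weak_partial_lin.
Qed.

Lemma wderiv_lin j (a : R) f g : H1space Omega f -> H1space Omega g ->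
  {ae leb d, forall x, Omega x -> wderiv Omega j (a *: f + g) x =
    a * wderiv Omega j f x + wderiv Omega j g x}.
Proof.
move=> Hf Hg; apply: (wderiv_ae (H1_lin a Hf Hg)); last exact: weak_partial_lin.
by apply: L2D => //; first apply: L2Z => //; exact: L2_wderiv.
Qed.

Lemma H1_test_fun phi : test_fun Omega phi -> H1space Omega phi.
Proof.
move=> tphi; split; first exact: (test_fun_L2 oO).
move=> j; exists (partial j phi); last exact: (test_fun_weak_partial oO).
exact/(test_fun_L2 oO)/(test_fun_partial).
Qed.

Lemma wderiv_test_fun j phi : test_fun Omega phi ->
  {ae leb d, forall x, Omega x -> wderiv Omega j phi x = partial j phi x}.
Proof.
move=> tphi; apply: wderiv_ae; first exact: H1_test_fun.
  exact/(test_fun_L2 oO)/(test_fun_partial).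
exact: (test_fun_weak_partial oO).
Qed.

Lemma ip_lin_le (a : R) f g : L2 Omega f -> L2 Omega g ->
  ip Omega (a *: f + g) (a *: f + g) <=
  2 * a ^+ 2 * ip Omega f f + 2 * ip Omega g g.
Proof.
move=> Lf Lg; have Laf := L2Z mO a Lf; have Lh := L2D mO Laf Lg.
have := ip_ge0 (Omega := Omega) (a *: f - g); have Lh' := L2B mO Laf Lg.
rewrite !ipDl//; try exact: L2N.
rewrite !ipZl// ipNl//.
rewrite (ipC f (a *: f - g)) (ipC g (a *: f - g)) (ipC f (_ + _)) (ipC g (_ + _)).
rewrite !ipDl//; try exact: L2N.
by rewrite !ipZl// !ipNl// (ipC g f); lra.
Qed.

Lemma cvg_ip_lin (a : R) (F G : nat -> 'rV[R]_d -> R) :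
  (forall n, L2 Omega (F n)) -> (forall n, L2 Omega (G n)) ->
  ip Omega (F n) (F n) @[n --> \oo] --> (0 : R) ->
  ip Omega (G n) (G n) @[n --> \oo] --> (0 : R) ->
  ip Omega (a *: F n + G n) (a *: F n + G n) @[n --> \oo] --> (0 : R).
Proof.
move=> LF LG F0 G0.
apply: (@squeeze_cvgr _ _ _ _ (cst 0)
  (fun n => 2 * a ^+ 2 * ip Omega (F n) (F n) + 2 * ip Omega (G n) (G n))).
- by apply: nearW => n; rewrite ip_ge0 ip_lin_le.
- exact: cvg_cst.
- rewrite -[X in _ --> X](addr0 0) -[X in _ --> X + _](mulr0 (2 * a ^+ 2)).
  rewrite -[X in _ --> _ + X](mulr0 2).
  by apply: cvgD; apply: cvgM => //; exact: cvg_cst.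
Qed.

(** The derivative of a f + g is a chosen representative; it is identified
    almost everywhere with the combination of those of f and g before the
    approximating sequences can be combined. *)
Lemma H10_lin (a : R) f g : H10space Omega f -> H10space Omega g ->
  H10space Omega (a *: f + g).
Proof.
move=> [Hf [phi [tphi f0 f1]]] [Hg [psi [tpsi g0 g1]]].
have Hfg := H1_lin a Hf Hg; split=> //.
have Lphi n := test_fun_L2 oO (tphi n); have Lpsi n := test_fun_L2 oO (tpsi n).
have Ljphi j n := test_fun_L2 oO (test_fun_partial j (tphi n)).
have Ljpsi j n := test_fun_L2 oO (test_fun_partial j (tpsi n)).
have [Lf _] := Hf; have [Lg _] := Hg.
exists (fun n => a *: phi n + psi n); split.
- by move=> n; apply: test_funD => //; exact: test_funZ.
- apply: (eq_cvgn _ (@cvg_ip_lin a (fun n => f - phi n) (fun n => g - psi n)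
    (fun n => L2B mO Lf (Lphi n)) (fun n => L2B mO Lg (Lpsi n)) f0 g0)) => n.
  apply: eq_Rintegral => x _; rewrite !fctE -expr2; congr (_ ^+ 2).
  by rewrite /GRing.scale/=; ring.
- move=> j.
  apply: (eq_cvgn _ (@cvg_ip_lin a (fun n => wderiv Omega j f - partial j (phi n))
    (fun n => wderiv Omega j g - partial j (psi n))
    (fun n => L2B mO (L2_wderiv j Hf) (Ljphi j n))
    (fun n => L2B mO (L2_wderiv j Hg) (Ljpsi j n)) (f1 j) (g1 j))) => n.
  have L1 := L2B mO (L2_wderiv j Hf) (Ljphi j n).
  have L2' := L2B mO (L2_wderiv j Hg) (Ljpsi j n).
  have L3 := L2D mO (L2Z mO a L1) L2'.
  have L4 : L2 Omega (wderiv Omega j (a *: f + g) - partial j (a *: phi n + psi n)).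
    apply: L2B => //; first exact: L2_wderiv.
    apply/(test_fun_L2 oO)/(test_fun_partial).
    by apply: test_funD => //; exact: test_funZ.
  have H : {ae leb d, forall x, Omega x ->
      (a *: (wderiv Omega j f - partial j (phi n)) +
       (wderiv Omega j g - partial j (psi n))) x =
      (wderiv Omega j (a *: f + g) - partial j (a *: phi n + psi n)) x}.
    apply: filterS (wderiv_lin j a Hf Hg) => x h Ox.
    rewrite !fctE h// partialD; last 2 first.
    + by move=> y; apply/smooth_differentiable/test_fun_smooth; exact: test_funZ.
    + by move=> y; exact/smooth_differentiable/test_fun_smooth.
    rewrite fctE [partial j (a *: phi n)]/partial /=.
    rewrite deriveZ; last exact/smooth_derivable/test_fun_smooth.
    by rewrite /partial /GRing.scale/=; ring.
  have [m3 m4] := (L2_measurable L3, L2_measurable L4).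
  rewrite (ae_eq_ipl mO m3 m4 m3 H) ipC (ae_eq_ipl mO m3 m4 m4 H).
  by apply: eq_Rintegral => x _; rewrite -expr2.
Qed.

Lemma H10_test_fun phi : test_fun Omega phi -> H10space Omega phi.
Proof.
move=> tphi; have Hphi := H1_test_fun tphi; split=> //.
exists (fun=> phi); split=> // [|j].
  rewrite (_ : (fun=> _) = cst 0); first exact: cvg_cst.
  apply/funext => n; rewrite /Rintegral integral0_eq// => x _.
  by rewrite subrr expr0n.
rewrite (_ : (fun=> _) = cst 0); first exact: cvg_cst.
apply/funext => n.
apply: (ae0_ip0 mO (f := wderiv Omega j phi - partial j phi)).
  apply: L2_measurable; apply: L2B => //; first exact: L2_wderiv.
  exact/(test_fun_L2 oO)/(test_fun_partial).
apply: filterS (wderiv_test_fun j tphi) => x h Ox.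
by rewrite !fctE h// subrr.
Qed.

End sobolev.

(** * Fields of matrices *)

Local Notation dotmx := Defs.dotmx (only parsing).

Section matrix_fields.
Context {R : realType}.

Lemma dotmxC m n (A B : 'M[R]_(m, n)) : dotmx A B = dotmx B A.
Proof. by apply: eq_bigr => i _; apply: eq_bigr => j _; rewrite mulrC. Qed.

Lemma dotmx_lin m n (a : R) (A B C : 'M[R]_(m, n)) :
  dotmx (a *: A + B) C = a * dotmx A C + dotmx B C.
Proof.
rewrite /dotmx mulr_sumr -big_split/=; apply: eq_bigr => i _.
rewrite mulr_sumr -big_split/=; apply: eq_bigr => j _.
by rewrite !mxE mulrDl mulrA.
Qed.

Lemma dotmx_ge0 m n (A : 'M[R]_(m, n)) : 0 <= dotmx A A.
Proof. by apply: sumr_ge0 => i _; apply: sumr_ge0 => j _; rewrite -expr2 sqr_ge0. Qed.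

Context {d : nat} {Omega : set 'rV[R]_d}.
Context (mO : measurable Omega).

Definition L2mx m n (F : 'rV[R]_d -> 'M[R]_(m, n)) :=
  forall i j, L2 Omega (fun x => F x i j).

Lemma L2mx_lin m n (a : R) (F G : 'rV[R]_d -> 'M[R]_(m, n)) :
  L2mx F -> L2mx G -> L2mx (a *: F + G).
Proof.
move=> LF LG i j.
rewrite (_ : (fun x => _) = a *: (fun x => F x i j) + (fun x => G x i j)).
  by apply: L2D => //; exact: L2Z.
by apply/funext => x; rewrite !fctE !mxE.
Qed.

Lemma dotmx_integrable m n (F G : 'rV[R]_d -> 'M[R]_(m, n)) :
  L2mx F -> L2mx G ->
  (leb d).-integrable Omega (fun x => (dotmx (F x) (G x))%:E).
Proof.
move=> LF LG; rewrite /dotmx; under eq_fun do rewrite -sumEFin.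
apply: integrable_sum => // i _; under eq_fun do rewrite -sumEFin.
by apply: integrable_sum => // j _; exact: L2_integrableM.
Qed.

Lemma Rintegral_sum I (s : seq I) (F : I -> 'rV[R]_d -> R) :
  (forall i, (leb d).-integrable Omega (EFin \o F i)) ->
  \int[leb d]_(x in Omega) (\sum_(i <- s) F i x) =
  \sum_(i <- s) \int[leb d]_(x in Omega) F i x.
Proof.
move=> iF; elim: s => [|i s IH].
  rewrite big_nil /Rintegral integral0_eq// => x _; by rewrite big_nil.
rewrite big_cons -IH -RintegralD//.
  by apply: eq_Rintegral => x _; rewrite big_cons.
have -> : EFin \o (fun x => \sum_(j <- s) F j x) =
    (fun x => \sum_(j <- s) (EFin \o F j) x)%E.
  by apply/funext => x; rewrite /= sumEFin.
exact: integrable_sum.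
Qed.

Lemma innerE m n (F G : 'rV[R]_d -> 'M[R]_(m, n)) : L2mx F -> L2mx G ->
  inner Omega F G =
  \sum_i \sum_j ip Omega (fun x => F x i j) (fun x => G x i j).
Proof.
move=> LF LG; have iFG i j := L2_integrableM mO (LF i j) (LG i j).
rewrite /inner /dotmx Rintegral_sum => [|i]; last first.
  rewrite (_ : _ \o _ = (fun x => \sum_j (F x i j * G x i j)%:E)%E).
    by apply: integrable_sum => // j _.
  by apply/funext => x; rewrite /= sumEFin.
apply: eq_bigr => i _; rewrite Rintegral_sum => [|j]; [by []|exact: iFG].
Qed.

Lemma innerC m n (F G : 'rV[R]_d -> 'M[R]_(m, n)) :
  inner Omega F G = inner Omega G F.
Proof. by apply: eq_Rintegral => x _; exact: dotmxC. Qed.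

Lemma inner_lin m n (a : R) (F G K : 'rV[R]_d -> 'M[R]_(m, n)) :
  L2mx F -> L2mx G -> L2mx K ->
  inner Omega (a *: F + G) K = a * inner Omega F K + inner Omega G K.
Proof.
move=> LF LG LK; have iF := dotmx_integrable LF LK; have iG := dotmx_integrable LG LK.
rewrite -RintegralZl// -RintegralD//; last exact: integrableZl iF.
by apply: eq_Rintegral => x _; rewrite !fctE dotmx_lin.
Qed.

Lemma innerZ m n (a : R) (F : 'rV[R]_d -> 'M[R]_(m, n)) : L2mx F ->
  inner Omega (a *: F) (a *: F) = a ^+ 2 * inner Omega F F.
Proof.
move=> LF; rewrite -RintegralZl//; last exact: dotmx_integrable.
apply: eq_Rintegral => x _; rewrite !fctE /dotmx mulr_sumr; apply: eq_bigr => i _.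
by rewrite mulr_sumr; apply: eq_bigr => j _; rewrite !mxE; ring.
Qed.

Lemma inner_ge0 m n (F : 'rV[R]_d -> 'M[R]_(m, n)) : 0 <= inner Omega F F.
Proof. by apply: Rintegral_ge0 => x _; exact: dotmx_ge0. Qed.

Lemma norm2_ge0 m n (F : 'rV[R]_d -> 'M[R]_(m, n)) : 0 <= norm2 Omega F.
Proof. exact: sqrtr_ge0. Qed.

Lemma sqr_norm2 m n (F : 'rV[R]_d -> 'M[R]_(m, n)) :
  norm2 Omega F ^+ 2 = inner Omega F F.
Proof. by rewrite sqr_sqrtr ?inner_ge0. Qed.

Lemma ae_eq_inner m n (F F' G G' : 'rV[R]_d -> 'M[R]_(m, n)) :
  L2mx F -> L2mx F' -> L2mx G -> L2mx G' ->
  {ae leb d, forall x, Omega x -> F x = F' x} ->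
  {ae leb d, forall x, Omega x -> G x = G' x} ->
  inner Omega F G = inner Omega F' G'.
Proof.
move=> LF LF' LG LG' FF' GG'; congr fine; apply: ae_eq_integral => //.
- exact: measurable_int (dotmx_integrable LF LG).
- exact: measurable_int (dotmx_integrable LF' LG').
- by apply: filterS2 FF' GG' => x h1 h2 Ox; rewrite h1// h2.
Qed.

End matrix_fields.
Arguments L2mx {R d} Omega {m n} F.

(** * The space X *)

Lemma cvg_sum0 (R : realType) (I : Type) (s : seq I) (F : I -> nat -> R) :
  (forall i, F i n @[n --> \oo] --> (0 : R)) ->
  \sum_(i <- s) F i n @[n --> \oo] --> (0 : R).
Proof.
move=> F0; elim: s => [|i s IH].
  by under eq_fun do rewrite big_nil; exact: cvg_cst.
under eq_fun do rewrite big_cons.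
have := cvgD (F0 i) IH; rewrite addr0; exact.
Qed.

Section fields.
Context {R : realType} {d : nat} {Omega : set 'rV[R]_d}.
Context (oO : open Omega).
Implicit Types (u v w : 'rV[R]_d -> 'rV[R]_d).

Let mO : measurable Omega := open_measurable_rV oO.

Lemma component_lin (a : R) v w i :
  component i (a *: v + w) = a *: component i v + component i w.
Proof. by apply/funext => x; rewrite /component !fctE !mxE. Qed.

Lemma X_lin (a : R) v w : Xspace Omega v -> Xspace Omega w ->
  Xspace Omega (a *: v + w).
Proof. by move=> Xv Xw i; rewrite component_lin; exact: (H10_lin oO). Qed.

Definition test_field v := forall i, test_fun Omega (component i v).

Lemma X_test_field v : test_field v -> Xspace Omega v.
Proof. by move=> tv i; exact: (H10_test_fun oO). Qed.

Lemma X_scale (a : R) v : Xspace Omega v -> Xspace Omega (a *: v).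
Proof.
by move=> Xv; rewrite -[a](subrK 1) scalerDl scale1r; exact: X_lin.
Qed.

Lemma X_sub v w : Xspace Omega v -> Xspace Omega w -> Xspace Omega (v - w).
Proof. by move=> Xv Xw; rewrite addrC -scaleN1r; exact: X_lin. Qed.

Lemma X_H1 v i : Xspace Omega v -> H1space Omega (component i v).
Proof. by move=> /(_ i)[]. Qed.

Lemma L2mx_X v : Xspace Omega v -> L2mx Omega v.
Proof. by move=> Xv i j; rewrite (ord1 i); have [[]] := Xv j. Qed.

Lemma L2mx_grad v : Xspace Omega v -> L2mx Omega (grad Omega v).
Proof.
move=> Xv i j; rewrite (_ : (fun x => _) = wderiv Omega j (component i v)).
  exact/L2_wderiv/X_H1.
by apply/funext => x; rewrite mxE.
Qed.

Lemma grad_lin (a : R) v w : Xspace Omega v -> Xspace Omega w ->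
  {ae leb d, forall x, Omega x ->
    grad Omega (a *: v + w) x = (a *: grad Omega v + grad Omega w) x}.
Proof.
move=> Xv Xw.
have : {ae leb d, forall x (i j : 'I_d), Omega x ->
    grad Omega (a *: v + w) x i j = (a *: grad Omega v + grad Omega w) x i j}.
  apply: filter_forall => i; apply: filter_forall => j.
  apply: filterS (wderiv_lin oO j a (X_H1 i Xv) (X_H1 i Xw)) => x h Ox.
  by rewrite !fctE !mxE component_lin h.
by apply: filterS => x h Ox; apply/matrixP => i j; exact: h.
Qed.

Lemma grad_scale (a : R) v : Xspace Omega v ->
  {ae leb d, forall x, Omega x -> grad Omega (a *: v) x = (a *: grad Omega v) x}.
Proof.
move=> Xv; have E (V : lmodType R) (z : V) : a *: z = (a - 1) *: z + z.
  by rewrite -{3}[z]scale1r -scalerDl subrK.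
apply: filterS (grad_lin (a - 1) Xv Xv) => x h Ox.
by rewrite E h// [in RHS]E.
Qed.

Lemma L2mx_scale m n (a : R) (F : 'rV[R]_d -> 'M[R]_(m, n)) :
  L2mx Omega F -> L2mx Omega (a *: F).
Proof.
by move=> LF; rewrite -[a](subrK 1) scalerDl scale1r; exact: L2mx_lin.
Qed.

Lemma norm2_gradZ (a : R) v : Xspace Omega v ->
  norm2 Omega (grad Omega (a *: v)) = `|a| * norm2 Omega (grad Omega v).
Proof.
move=> Xv; apply/eqP; rewrite -(@eqrXn2 _ 2)// ?mulr_ge0 ?norm2_ge0//.
have LX := L2mx_grad Xv.
have E w := sqr_norm2 (Omega := Omega) (grad Omega w).
rewrite E (exprMn _ `|a|) E real_normK ?num_real//.
rewrite -(innerZ mO a LX).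
have Lav := L2mx_grad (X_scale a Xv); have L1 := L2mx_scale a LX.
have h := grad_scale a Xv.
by rewrite (ae_eq_inner mO Lav L1 Lav L1 h h).
Qed.

(** The definition of H10 approximates each component; the squared gradient norm
    is the finite sum of the errors on the partial derivatives. *)
Lemma X_approx v : Xspace Omega v ->
  exists Phi : nat -> 'rV[R]_d -> 'rV[R]_d,
    (forall n, test_field (Phi n)) /\
    norm2 Omega (grad Omega (v - Phi n)) @[n --> \oo] --> (0 : R).
Proof.
move=> Xv; have [phi Hphi] := choice (fun i => (Xv i).2).
pose Phi n x : 'rV[R]_d := \row_i phi i n x.
have cPhi n i : component i (Phi n) = phi i n.
  by apply/funext => x; rewrite /component mxE.
have tPhi n : test_field (Phi n).
  by move=> i; rewrite cPhi; have [] := Hphi i.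
exists Phi; split=> //.
have tphi i n : test_fun Omega (phi i n) by have [] := Hphi i.
have XPhi n := X_test_field (tPhi n).
have Xe n := X_sub Xv (XPhi n).
have ipE n i j : ip Omega (fun x => grad Omega (v - Phi n) x i j)
      (fun x => grad Omega (v - Phi n) x i j) =
    \int[leb d]_(x in Omega)
      ((wderiv Omega j (component i v) x - partial j (phi i n) x) ^+ 2).
  set g := wderiv Omega j (component i v) - partial j (phi i n).
  have Lg : L2 Omega g.
    apply: L2B => //; first exact/L2_wderiv/X_H1.
    exact/(test_fun_L2 oO)/test_fun_partial.
  have Le := L2mx_grad (Xe n) i j.
  have h : {ae leb d, forall x, Omega x -> grad Omega (v - Phi n) x i j = g x}.
    have h1 := grad_lin (-1) (XPhi n) Xv.
    have h2 := wderiv_test_fun oO j (tphi i n).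
    apply: filterS2 h1 h2 => x h1 h2 Ox.
    rewrite addrC -scaleN1r h1// !fctE !mxE cPhi h2//.
    by rewrite mulN1r addrC.
  have [m1 m2] := (L2_measurable Le, L2_measurable Lg).
  rewrite (ae_eq_ipl mO m1 m2 m1 h) ipC (ae_eq_ipl mO m1 m2 m2 h).
  by apply: eq_Rintegral => x _; rewrite -expr2.
have : inner Omega (grad Omega (v - Phi n)) (grad Omega (v - Phi n))
    @[n --> \oo] --> (0 : R).
  apply: (@eq_cvgn _ (fun n => \sum_i \sum_j \int[leb d]_(x in Omega)
      ((wderiv Omega j (component i v) x - partial j (phi i n) x) ^+ 2))).
    move=> n; rewrite (innerE mO (L2mx_grad (Xe n)) (L2mx_grad (Xe n))).
    by apply: eq_bigr => i _; apply: eq_bigr => j _; rewrite ipE.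
  apply: cvg_sum0 => i; apply: cvg_sum0 => j.
  by have [_ _] := Hphi i; exact.
move=> h; have := continuous_cvg _ (@sqrt_continuous R 0) h.
by rewrite sqrtr0; exact.
Qed.

End fields.
Arguments test_field {R d} Omega v.

(** * Divergence-free fields *)

Section divergence_free.
Context {R : realType} {d : nat} {Omega : set 'rV[R]_d}.
Context (oO : open Omega).
Implicit Types (u v w : 'rV[R]_d -> 'rV[R]_d) (phi psi : 'rV[R]_d -> R).

Let mO : measurable Omega := open_measurable_rV oO.

Definition divergence w x : R := \tr (grad Omega w x).

Lemma divergenceE w : divergence w =
  (fun x => \sum_i wderiv Omega i (component i w) x).
Proof. by apply/funext => x; apply: eq_bigr => i _; rewrite mxE. Qed.

Lemma L2_divergence w : Xspace Omega w -> L2 Omega (divergence w).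
Proof.
move=> Xw; rewrite divergenceE; apply: L2_sum => // i.
exact/L2_wderiv/X_H1.
Qed.

Lemma integrable_indic_fin B : measurable B -> (leb d B < +oo)%E ->
  (leb d).-integrable Omega (EFin \o (\1_B : 'rV[R]_d -> R)).
Proof.
move=> mB Boo; apply/integrableP; split.
  by apply/measurable_EFinP; exact: measurable_funTS.
under eq_integral do rewrite /= ger0_norm//.
rewrite integral_indic//; apply: le_lt_trans Boo; apply: le_measure; rewrite ?inE//.
exact: measurableI.
Qed.

Lemma L2_indic B : measurable B -> (leb d B < +oo)%E ->
  L2 Omega (\1_B : 'rV[R]_d -> R).
Proof.
move=> mB Boo; split; first exact: measurable_funTS.
have -> : (fun x : 'rV[R]_d => ((\1_B x : R) ^+ 2)%:E) = EFin \o \1_B.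
  by apply/funext => x; rewrite /= indicE; case: (_ \in _); rewrite ?expr1n ?expr0n.
exact: integrable_indic_fin.
Qed.

(** It is the limit of integrals of derivatives of test functions: on a set of
    finite measure, L2 convergence implies convergence of integrals. *)
Lemma integral_wderiv_eq0 f i : (leb d Omega < +oo)%E -> H10space Omega f ->
  \int[leb d]_(x in Omega) wderiv Omega i f x = 0.
Proof.
move=> Ooo [Hf [phi [tphi _ /(_ i) f1]]].
have L1 := L2_cst mO 1 Ooo.
have Lw := L2_wderiv i Hf.
have Lp n := test_fun_L2 oO (test_fun_partial i (tphi n)).
set I := Rintegral _ _ _.
have IE n : I = ip Omega (wderiv Omega i f - partial i (phi n)) (cst 1).
  rewrite ipBl// [X in _ - X](_ : _ = 0) ?subr0.
    by apply: eq_Rintegral => x _; rewrite mulr1.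
  rewrite -[RHS](integral_test_fun_partial i (tphi n)).
  by apply: eq_Rintegral => x _; rewrite mulr1.
suff : I ^+ 2 <= 0 by rewrite le_eqVlt ltNge sqr_ge0 orbF sqrf_eq0 => /eqP.
have : ip Omega (cst 1) (cst 1) * \int[leb d]_(x in Omega)
    ((wderiv Omega i f x - partial i (phi n) x) ^+ 2) @[n --> \oo] -->
    ip Omega (cst 1) (cst 1) * (0 : R).
  by apply: cvgM f1; exact: cvg_cst.
rewrite mulr0 => /cvgr_to_ge; apply; apply: nearW => n; rewrite (IE n).
have Ld := L2B mO Lw (Lp n).
by rewrite mulrC; exact: (cauchy_schwarz_ip mO Ld L1).
Qed.

(** Multipliers in Q have mean zero. Subtracting from psi its integral spread
    uniformly over B produces one. *)
Lemma V_ip_divergence w psi B : Vspace Omega w -> L2 Omega psi ->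
  (leb d).-integrable Omega (EFin \o psi) ->
  measurable B -> B `<=` Omega -> (0 < leb d B)%E -> (leb d B < +oo)%E ->
  ip Omega (divergence w) psi * fine (leb d B) =
  (\int[leb d]_(x in Omega) psi x) * ip Omega (divergence w) \1_B.
Proof.
move=> [Xw Vw] Lpsi ipsi mB BO B0 Boo.
have LB := L2_indic mB Boo; have LD := L2_divergence Xw.
have b0 : 0 < fine (leb d B) by rewrite fine_gt0// B0.
set c := (\int[leb d]_(x in Omega) psi x) / fine (leb d B).
have LcB := L2Z mO c LB.
have iB : (leb d).-integrable Omega (EFin \o (\1_B : 'rV[R]_d -> R)).
  exact: integrable_indic_fin.
have Q : Qspace Omega (psi - c *: \1_B).
  split; first exact: L2B.
  have icB : (leb d).-integrable Omega (EFin \o (c *: (\1_B : 'rV[R]_d -> R))).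
    exact: integrableZl iB.
  have iq := integrableB mO ipsi icB.
  rewrite -[LHS]fineK ?(integrable_fin_num mO iq)//; congr EFin.
  have -> : fine (\int[leb d]_(x in Omega) ((psi - c *: \1_B) x)%:E) =
    \int[leb d]_(x in Omega) psi x - \int[leb d]_(x in Omega) (c *: \1_B) x.
    by rewrite -RintegralB.
  rewrite RintegralZl// {2}/Rintegral integral_indic// (setIidl BO).
  by rewrite /c divfK ?subrr// gt_eqF.
have := Vw _ Q; rewrite -/(ip Omega (divergence w) (psi - c *: \1_B)).
rewrite ipBr// (ipC (divergence w) (c *: _)) ipZl// (ipC _ (divergence w)).
move=> /eqP; rewrite subr_eq0 => /eqP ->.
by rewrite /c mulrAC divfK// gt_eqF.
Qed.

(** The constraint on V only speaks of multipliers of mean zero, and the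
    correction term of [V_ip_divergence] has to be removed. If Omega has finite
    measure, take B = Omega: the divergence has integral zero since w vanishes
    on the boundary. Otherwise let the measure of B tend to infinity: by
    Cauchy-Schwarz the integral of the divergence over B grows at most like the
    square root of this measure. *)
Lemma V_ip_test w psi : Vspace Omega w -> test_fun Omega psi ->
  ip Omega (divergence w) psi = 0.
Proof.
move=> Vw tpsi; have [Xw _] := Vw; have LD := L2_divergence Xw.
have Lpsi := test_fun_L2 oO tpsi; have ipsi := test_fun_integrable oO tpsi.
have [Ooo|Ooo] := ltP (leb d Omega) +oo%E.
  have := measure_ge0 (leb d) Omega; rewrite le_eqVlt => /orP[/eqP O0|O0].
    have D0 : {ae leb d, forall x, Omega x -> divergence w x = (0 : 'rV[R]_d -> R) x}.
      by exists Omega; split=> // x /= /not_implyP[].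
    rewrite (ae_eq_ipl mO (L2_measurable LD) (L2_measurable (L2_0 mO))
      (L2_measurable Lpsi) D0).
    by rewrite /ip /Rintegral integral0_eq// => x _; rewrite mul0r.
  have := V_ip_divergence Vw Lpsi ipsi mO (@subset_refl _ _) O0 Ooo.
  rewrite [X in _ = _ * X](_ : _ = 0).
    rewrite mulr0 => /eqP; rewrite mulf_eq0 => /orP[/eqP//|].
    by rewrite gt_eqF// fine_gt0// O0.
  have iw i : (leb d).-integrable Omega (EFin \o wderiv Omega i (component i w)).
    by apply: L2_integrable => //; exact/L2_wderiv/X_H1.
  transitivity (\int[leb d]_(x in Omega) \sum_i wderiv Omega i (component i w) x).
    by apply: eq_Rintegral => x xO; rewrite divergenceE indicE xO mulr1.
  rewrite Rintegral_sum// big1// => i _.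
  by apply: integral_wderiv_eq0.
apply/eqP/negPn/negP => p0.
pose C := (\int[leb d]_(x in Omega) psi x) ^+ 2 *
  ip Omega (divergence w) (divergence w).
(* If the integral were nonzero, this would bound the measure of B. *)
have HB B : measurable B -> B `<=` Omega -> (leb d B < +oo)%E ->
    ip Omega (divergence w) psi ^+ 2 * fine (leb d B) <= C.
  move=> mB BO Boo; have := measure_ge0 (leb d) B; rewrite le_eqVlt => /orP[/eqP <-|B0].
    by rewrite mulr0 mulr_ge0 ?sqr_ge0 ?ip_ge0.
  have b0 : 0 < fine (leb d B) by rewrite fine_gt0// B0.
  have LB := L2_indic mB Boo.
  have h := V_ip_divergence Vw Lpsi ipsi mB BO B0 Boo.
  have BB : ip Omega (\1_B) (\1_B) = fine (leb d B).
    transitivity (\int[leb d]_(x in Omega) (\1_B x : R)).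
      apply: eq_Rintegral => x _; rewrite indicE.
      by case: (_ \in _); rewrite ?mulr1 ?mulr0.
    by rewrite /Rintegral integral_indic// (setIidl BO).
  have CS := cauchy_schwarz_ip mO LD LB; rewrite BB in CS.
  rewrite -(ler_pM2r b0) /C.
  have -> : ip Omega (divergence w) psi ^+ 2 * fine (leb d B) * fine (leb d B) =
      (\int[leb d]_(x in Omega) psi x) ^+ 2 * ip Omega (divergence w) \1_B ^+ 2.
    by rewrite -[RHS]exprMn -h; ring.
  by rewrite -[leRHS]mulrA; apply: ler_wpM2l CS; exact: sqr_ge0.
pose B (n : nat) := Omega `&` cbox (const_mx (- n%:R)) (const_mx n%:R).
have mB n : measurable (B n) by apply: measurableI => //; exact: measurable_cbox.
have Boo n : (leb d (B n) < +oo)%E.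
  apply: le_lt_trans (leb_cbox_fin (const_mx (- n%:R)) (const_mx n%:R)).
  by apply: le_measure; rewrite ?inE//; [exact: measurable_cbox|exact: subIsetr].
have ndB : nondecreasing_seq B.
  move=> n m nm; apply/subsetPset => x [Ox xB]; split=> // i.
  have /andP[h1 h2] := xB i; rewrite !mxE in h1 h2 *.
  have nm' : n%:R <= m%:R :> R by rewrite ler_nat.
  by apply/andP; split; lra.
have BU : \bigcup_n B n = Omega.
  apply/seteqP; split=> [x [n _ []]//|x Ox].
  exists (Num.truncn `|x|).+1 => //; split=> // i; rewrite !mxE -ler_norml.
  apply: (@le_trans _ _ `|x|); last by apply/ltW; exact: truncnS_gt.
  rewrite [leRHS]mx_normrE.
  by apply: (le_trans _ (le_bigmax _ _ (ord0, i))).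
have Oy : leb d Omega = +oo%E by apply/eqP; rewrite eq_le leey Ooo.
have := nondecreasing_cvg_mu mB (bigcupT_measurable B mB) ndB; rewrite BU => Bcvg.
have {}Bcvg : leb d (B n) @[n --> \oo] --> +oo%E by rewrite -Oy; exact: Bcvg.
have P0 : 0 < ip Omega (divergence w) psi ^+ 2 by rewrite exprn_even_gt0.
have /cvgey_ge/(_ (C / ip Omega (divergence w) psi ^+ 2 + 1))
  [n _ /(_ n (leqnn n))] /= := Bcvg.
rewrite -[X in (_ <= X)%E]fineK ?ge0_fin_numE// lee_fin => h.
have := HB _ (mB n) (@subIsetl _ _ _) (Boo n).
rewrite mulrC -ler_pdivlMr//; lra.
Qed.

End divergence_free.

(** * The convection form *)

Lemma le_vanishing_eq0 (R : realType) (b C D : R) (e : nat -> R) :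
  e n @[n --> \oo] --> (0 : R) ->
  (forall n, `|b| <= C * (D * e n + e n ^+ 2)) -> b = 0.
Proof.
move=> e0 be; apply/eqP; rewrite -normr_le0.
have : C * (D * e n + e n ^+ 2) @[n --> \oo] --> C * (D * 0 + 0 ^+ 2).
  apply: cvgM; first exact: cvg_cst.
  apply: cvgD; first by apply: cvgM => //; exact: cvg_cst.
  by apply: cvgM.
rewrite expr0n/= !mulr0 addr0 mulr0 => /cvgr_to_ge; apply.
exact: nearW.
Qed.

Section convection.
Context {R : realType} {d : nat} {Omega : set 'rV[R]_d} {M : R}.
Context (oO : open Omega) (bM : b_bound Omega M).
Implicit Types (u v w : 'rV[R]_d -> 'rV[R]_d) (phi psi : 'rV[R]_d -> R).

Let mO : measurable Omega := open_measurable_rV oO.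

Local Notation G v := (norm2 Omega (grad Omega v)).

Lemma bform_integrable u w v : Xspace Omega u -> Xspace Omega w ->
  Xspace Omega v ->
  (leb d).-integrable Omega (EFin \o (fun x => dotmx (convect Omega u w x) (v x))).
Proof. by move=> Xu Xw Xv; have [] := bM Xu Xw Xv. Qed.

Lemma bform_linr (a : R) u w v1 v2 : Xspace Omega u -> Xspace Omega w ->
  Xspace Omega v1 -> Xspace Omega v2 ->
  bform Omega u w (a *: v1 + v2) = a * bform Omega u w v1 + bform Omega u w v2.
Proof.
move=> Xu Xw X1 X2.
have i1 := bform_integrable Xu Xw X1; have i2 := bform_integrable Xu Xw X2.
rewrite /bform /inner -(RintegralZl _ mO i1) -(RintegralD mO _ i2); last first.
  exact: integrableZl i1.
apply: eq_Rintegral => x _.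
rewrite dotmxC (dotmxC (convect _ _ _ _)) (dotmxC (convect _ _ _ _) (v2 x)).
by rewrite !fctE dotmx_lin.
Qed.

Lemma bform_linm (a : R) u w1 w2 v : Xspace Omega u -> Xspace Omega w1 ->
  Xspace Omega w2 -> Xspace Omega v ->
  bform Omega u (a *: w1 + w2) v = a * bform Omega u w1 v + bform Omega u w2 v.
Proof.
move=> Xu X1 X2 Xv.
have i1 := bform_integrable Xu X1 Xv; have i2 := bform_integrable Xu X2 Xv.
have i12 := bform_integrable Xu (X_lin oO a X1 X2) Xv.
have ai1 := integrableZl mO a i1.
rewrite /bform /inner -(RintegralZl _ mO i1) -(RintegralD mO ai1 i2).
congr fine; apply: ae_eq_integral => //.
- exact: measurable_int i12.
- exact: measurable_int (integrableD mO ai1 i2).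
apply: filterS (grad_lin oO a X1 X2) => x h Ox.
rewrite /= /convect h// !fctE linearP/= mulmxDr -scalemxAr.
by rewrite dotmx_lin.
Qed.

(** The bound on b is one-sided; it is applied to v and to - v. *)
Lemma bform_normr u w v : Xspace Omega u -> Xspace Omega w -> Xspace Omega v ->
  `|bform Omega u w v| <= M * G u * G w * G v.
Proof.
move=> Xu Xw Xv; have [_ _ h1] := bM Xu Xw Xv.
have XN := X_scale oO (-1) Xv; have [_ _ h2] := bM Xu Xw XN.
rewrite norm2_gradZ// normrN1 mul1r in h2.
have := bform_linr (-1 - 1) Xu Xw Xv Xv.
have -> : (-1 - 1) *: v + v = -1 *: v by rewrite scalerBl scale1r subrK.
move=> h3; move: h1 h2; rewrite h3.
move: (bform Omega u w v) (M * G u * G w * G v) => b K h1 h2.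
by rewrite ler_norml; apply/andP; split=> //; lra.
Qed.

(** w . grad (|v|^2 / 2) integrates to minus the integral of (div w) |v|^2 / 2,
    where |v|^2 / 2 is a test function. *)
Lemma bform_test_field w v : Vspace Omega w -> test_field Omega v ->
  bform Omega w v v = 0.
Proof.
move=> Vw tv; have [Xw _] := Vw; have Xv := X_test_field oO tv.
(* psi = |v|^2 / 2 *)
pose psi : 'rV[R]_d -> R := fun x => \sum_i (2^-1 *: (component i v * component i v)) x.
have tpsi : test_fun Omega psi.
  apply: test_fun_sum => i; apply: test_funZ; apply: test_funM; first exact: tv.
  exact/test_fun_smooth/tv.
have psiE k x : partial k psi x = \sum_i component i v x * partial k (component i v) x.
  have -> : psi = \sum_i (2^-1 *: (component i v * component i v)).
    by apply/funext => y; rewrite /psi fct_sumE.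
  have dc i : derivable (component i v) x (delta_mx ord0 k).
    exact/smooth_derivable/test_fun_smooth/tv.
  have dcc i : derivable (component i v * component i v) x (delta_mx ord0 k).
    exact: derivableM.
  rewrite /partial derive_sum => [|i]; last exact: derivableZ.
  apply: eq_bigr => i _; rewrite deriveZ// deriveM// /GRing.scale/=.
  by set D := 'D__ _ _; set c := component i v x; field.
have Lw k : L2 Omega (component k w) by have [[]] := Xw k.
have Lk k := test_fun_L2 oO (test_fun_partial k tpsi).
have Lpsi := test_fun_L2 oO tpsi.
transitivity (\int[leb d]_(x in Omega) (\sum_k component k w x * partial k psi x)).
  have ib := bform_integrable Xw Xv Xv.
  have h : {ae leb d, forall x (i k : 'I_d), Omega x ->
      wderiv Omega k (component i v) x = partial k (component i v) x}.
    apply: filter_forall => i; apply: filter_forall => k.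
    exact: wderiv_test_fun.
  congr fine; apply: ae_eq_integral => //.
  - exact: measurable_int ib.
  - apply/measurable_EFinP; apply: measurable_sum => k.
    by apply: measurable_funM; apply: L2_measurable.
  apply: filterS h => x h Ox; rewrite /dotmx big_ord1; congr EFin.
  under eq_bigr => i _ do rewrite mxE mulr_suml.
  rewrite exchange_big/=; apply: eq_bigr => k _; rewrite psiE mulr_sumr.
  apply: eq_bigr => i _; rewrite !mxE h// /component.
  by rewrite -mulrA; congr (_ * _); exact: mulrC.
rewrite Rintegral_sum//; last by move=> k; exact: L2_integrableM (Lw k) (Lk k).
transitivity (- ip Omega (divergence (Omega := Omega) w) psi); last first.
  by rewrite V_ip_test// oppr0.
have LD k : L2 Omega (wderiv Omega k (component k w)) by exact/L2_wderiv/X_H1.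
transitivity (- \sum_k ip Omega (wderiv Omega k (component k w)) psi).
  rewrite -sumrN; apply: eq_bigr => k _.
  by rewrite -(ip_wderiv k (X_H1 k Xw) tpsi).
congr (- _); rewrite divergenceE -Rintegral_sum//.
  by apply: eq_Rintegral => x _; rewrite mulr_suml.
by move=> k; exact: L2_integrableM (LD k) Lpsi.
Qed.

(** With e_n = v - Phi_n for test fields Phi_n approaching v, expanding
    0 = b(w, v - e_n, v - e_n) expresses b(w, v, v) by terms that contain e_n. *)
Lemma bform_skew w v : Vspace Omega w -> Xspace Omega v ->
  bform Omega w v v = 0.
Proof.
move=> Vw Xv; have [Xw _] := Vw.
have [Phi [tPhi ePhi]] := X_approx oO Xv.
have XPhi n := X_test_field oO (tPhi n).
have Xe n := X_sub oO Xv (XPhi n).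
pose e n := v - Phi n.
have bE n : `|bform Omega w v v| <= `|M| * G w * (2 * G v * G (e n) + G (e n) ^+ 2).
  have := bform_test_field Vw (tPhi n).
  have -> : Phi n = -1 *: e n + v by rewrite /e scaleN1r opprB subrK.
  have Xe' := X_lin oO (-1) (Xe n) Xv.
  rewrite (bform_linm (-1) Xw (Xe n) Xv Xe').
  rewrite (bform_linr (-1) Xw (Xe n) (Xe n) Xv) (bform_linr (-1) Xw Xv (Xe n) Xv).
  have h1 := bform_normr Xw (Xe n) Xv.
  have h2 := bform_normr Xw Xv (Xe n).
  have h3 := bform_normr Xw (Xe n) (Xe n).
  have Gw := norm2_ge0 (Omega := Omega) (grad Omega w).
  have Gv := norm2_ge0 (Omega := Omega) (grad Omega v).
  have Ge := norm2_ge0 (Omega := Omega) (grad Omega (e n)).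
  move: h1 h2 h3 Gw Gv Ge; rewrite -/(e n).
  move: (G w) (G v) (G (e n)) (bform Omega w v v) (bform Omega w (e n) v)
    (bform Omega w v (e n)) (bform Omega w (e n) (e n)).
  move=> Nw Nv Ne bvv bev bve bee h1 h2 h3 Nw0 Nv0 Ne0 h0.
  have -> : bvv = bev + bve - bee by lra.
  apply: le_trans (ler_normB _ _) _; apply: le_trans (lerD (ler_normD _ _) (lexx _)) _.
  have A0 : 0 <= Nw * (2 * Nv * Ne + Ne ^+ 2).
    by rewrite mulr_ge0// addr_ge0 ?sqr_ge0// !mulr_ge0.
  apply: (@le_trans _ _ (M * (Nw * (2 * Nv * Ne + Ne ^+ 2)))); last first.
    by rewrite -[leRHS]mulrA; apply: ler_wpM2r => //; exact: ler_norm.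
  lra.
exact: (le_vanishing_eq0 ePhi bE).
Qed.

End convection.

(** * The dual norm and the energy estimate *)

Section duality.
Context {R : realType} {d : nat} {Omega : set 'rV[R]_d}.
Context (oO : open Omega).
Context {f : ('rV[R]_d -> 'rV[R]_d) -> R} (Hf : Hm1space Omega f).

Lemma Hm1_scale (a : R) v : Xspace Omega v -> f (a *: v) = a * f v.
Proof.
have [flin _] := Hf; move=> Xv.
have -> : a *: v = (a - 1) *: v + v by rewrite scalerBl scale1r subrK.
by rewrite flin// mulrBl mul1r subrK.
Qed.

(** A field of nonzero gradient norm is normalized into the unit ball; on the
    others boundedness forces <f, v> <= 0. *)
Lemma Hm1_le v : Xspace Omega v ->
  f v <= norm_m1 Omega f * norm2 Omega (grad Omega v).
Proof.
move=> Xv; have [_ [C fC]] := Hf.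
have := norm2_ge0 (Omega := Omega) (grad Omega v).
rewrite le_eqVlt => /orP[/eqP g0|g0].
  have := fC _ Xv; rewrite -g0 !mulr0; apply: le_trans; exact: ler_norm.
rewrite -ler_pdivrMr// mulrC -Hm1_scale//.
set w := _ *: v; have Xw : Xspace Omega w by exact: X_scale.
have gw : norm2 Omega (grad Omega w) = 1.
  by rewrite norm2_gradZ// ger0_norm ?invr_ge0 ?ltW// mulVf// gt_eqF.
apply: ub_le_sup; last by exists w => //; split=> //; rewrite gw.
exists `|C| => _ [z [Xz z1] <-].
apply: le_trans (ler_norm _) _; apply: le_trans (fC _ Xz) _.
apply: le_trans (ler_norm _) _; rewrite normrM ler_piMr//.
by rewrite ger0_norm; [exact: z1|exact: norm2_ge0].
Qed.

End duality.

Section inner_inequalities.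
Context {R : realType} {d : nat} {Omega : set 'rV[R]_d}.
Context (mO : measurable Omega) {m n : nat}.
Implicit Types F G : 'rV[R]_d -> 'M[R]_(m, n).

Lemma inner_quad (a : R) F G : L2mx Omega F -> L2mx Omega G ->
  inner Omega (a *: F + G) (a *: F + G) =
  a ^+ 2 * inner Omega F F + 2 * a * inner Omega F G + inner Omega G G.
Proof.
move=> LF LG; have LH := L2mx_lin mO a LF LG.
rewrite (inner_lin mO a LF LG LH) (innerC F) (innerC G).
rewrite (inner_lin mO a LF LG LF) (inner_lin mO a LF LG LG) (innerC G F).
by move: (inner _ F F) (inner _ F G) (inner _ G G) => x y z; ring.
Qed.

Lemma inner_young F G : L2mx Omega F -> L2mx Omega G ->
  2 * inner Omega F G <= inner Omega F F + inner Omega G G.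
Proof.
move=> LF LG; have := inner_ge0 (Omega := Omega) (-1 *: F + G).
rewrite inner_quad//.
by move: (inner _ F F) (inner _ F G) (inner _ G G) => x y z; lra.
Qed.

Lemma inner_lin_le (a : R) F G : L2mx Omega F -> L2mx Omega G ->
  inner Omega (a *: F + G) (a *: F + G) <=
  2 * a ^+ 2 * inner Omega F F + 2 * inner Omega G G.
Proof.
move=> LF LG; have := inner_ge0 (Omega := Omega) (- a *: F + G).
rewrite !inner_quad// sqrrN.
by move: (inner _ F F) (inner _ F G) (inner _ G G) => x y z; lra.
Qed.

End inner_inequalities.

Section energy_arithmetic.
Context {R : realType}.

Lemma energy_bound (nu g fu N : R) : 0 < nu -> 0 <= g ->
  nu * g ^+ 2 = fu -> fu <= N * g -> g ^+ 2 <= nu ^- 2 * N ^+ 2.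
Proof.
move=> nu0; rewrite le_eqVlt => /orP[/eqP <- _ _|g0 <-].
  by rewrite expr0n/= -exprVn -exprMn sqr_ge0.
rewrite expr2 mulrA ler_pM2r// => h.
rewrite ler_pdivlMl ?exprn_gt0// -exprMn.
by apply: lerXn2r => //; rewrite nnegrE ?(le_trans _ h)// mulr_ge0 ?ltW.
Qed.

(** The estimate as a statement on real numbers: g = |grad v|, J = |I v|^2,
    W = |v|^2, s = |I v - v|^2, e = |I u + I eps|^2, c = (I u + I eps, I v),
    A = |I u|^2, B = |I eps|^2, gu = |grad u| and N = |f|_(-1). *)
Lemma energy_balance (nu mu CI H CP N g J W s e c A B fv gu : R) :
  0 < nu -> 0 < mu -> 0 < H -> 0 < CI ->
  nu * g ^+ 2 + mu * (J - c) = fv -> fv <= N * g ->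
  2 * c <= e + J -> e <= 2 * A + 2 * B -> W <= 2 * J + 2 * s ->
  s <= (CI * H * g) ^+ 2 -> A <= CI ^+ 2 * CP ^+ 2 * gu ^+ 2 ->
  gu ^+ 2 <= nu ^- 2 * N ^+ 2 -> 0 <= J -> 0 <= s -> 0 <= W ->
  nu / 2 * g ^+ 2 + lambda_hat nu mu CI H * W <=
  nu^-1 * N ^+ 2 + 2 * mu * CI ^+ 2 * CP ^+ 2 * nu ^- 2 * N ^+ 2 + 2 * mu * B.
Proof.
move=> nu0 mu0 H0 CI0 bal fvN cJ eAB WJs sg Agu guN J0 s0 W0.
have D0 : 0 < 4 * CI ^+ 2 * H ^+ 2 by rewrite !mulr_gt0 ?exprn_gt0.
have l0 : 0 <= lambda_hat nu mu CI H.
  by rewrite le_min !divr_ge0// ?ltW.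
have l1 : lambda_hat nu mu CI H <= nu / (4 * CI ^+ 2 * H ^+ 2) by rewrite ge_min lexx.
have l2 : lambda_hat nu mu CI H <= mu / 2 by rewrite ge_min lexx orbT.
move: (lambda_hat nu mu CI H) l0 l1 l2 => l l0 l1 l2.
have lW : l * W <= mu * J + nu / 2 * g ^+ 2.
  apply: (@le_trans _ _ (l * (2 * J + 2 * s))); first exact: ler_wpM2l.
  have h1 : l * J <= mu / 2 * J by exact: ler_wpM2r.
  have h2 : l * s <= nu / (4 * CI ^+ 2 * H ^+ 2) * (CI * H * g) ^+ 2.
    by apply: ler_pM.
  have h3 : nu / (4 * CI ^+ 2 * H ^+ 2) * (CI * H * g) ^+ 2 = nu / 4 * g ^+ 2.
    by field; rewrite !gt_eqF.
  rewrite h3 in h2; lra.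
have Ng : N * g <= nu / 2 * g ^+ 2 + nu^-1 / 2 * N ^+ 2.
  have : 0 <= nu^-1 / 2 * (nu * g - N) ^+ 2.
    by rewrite mulr_ge0 ?sqr_ge0// divr_ge0// invr_ge0 ltW.
  suff -> : nu^-1 / 2 * (nu * g - N) ^+ 2 =
    nu / 2 * g ^+ 2 + nu^-1 / 2 * N ^+ 2 - N * g by rewrite subr_ge0.
  by field; rewrite gt_eqF.
have main : nu * g ^+ 2 + mu * J <= nu^-1 * N ^+ 2 + mu * e.
  have h1 : mu * (2 * c) <= mu * (e + J) by rewrite ler_pM2l.
  lra.
have AN : A <= CI ^+ 2 * CP ^+ 2 * (nu ^- 2 * N ^+ 2).
  apply: le_trans Agu _; apply: ler_wpM2l => //.
  by rewrite mulr_ge0 ?sqr_ge0.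
have me : mu * e <= mu * (2 * (CI ^+ 2 * CP ^+ 2 * (nu ^- 2 * N ^+ 2)) + 2 * B).
  by rewrite ler_pM2l//; lra.
lra.
Qed.

Lemma lambda_hat_small_mu (nu mu CI H : R) : 0 < H -> 0 < CI ->
  mu <= nu / (2 * CI ^+ 2 * H ^+ 2) -> lambda_hat nu mu CI H = mu / 2.
Proof.
move=> H0 CI0 h; rewrite /lambda_hat; apply/min_r.
suff -> : nu / (4 * CI ^+ 2 * H ^+ 2) = nu / (2 * CI ^+ 2 * H ^+ 2) / 2.
  by rewrite ler_pM2r.
by field; rewrite !gt_eqF.
Qed.

Lemma energy_small_mu (nu mu CI CP N g W B : R) : 0 < nu -> 0 < mu ->
  nu / 2 * g ^+ 2 + mu / 2 * W <=
  nu^-1 * N ^+ 2 + 2 * mu * CI ^+ 2 * CP ^+ 2 * nu ^- 2 * N ^+ 2 + 2 * mu * B ->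
  W <= 2 * mu^-1 * nu^-1 * N ^+ 2 + 4 * CI ^+ 2 * CP ^+ 2 * nu ^- 2 * N ^+ 2 + 4 * B.
Proof.
move=> nu0 mu0 h.
have h1 : mu / 2 * W <= nu^-1 * N ^+ 2 +
    2 * mu * CI ^+ 2 * CP ^+ 2 * nu ^- 2 * N ^+ 2 + 2 * mu * B.
  apply: le_trans h; rewrite lerDr mulr_ge0 ?sqr_ge0// divr_ge0// ltW//.
have m2 : 0 < mu / 2 by rewrite divr_gt0.
rewrite -(ler_pM2l m2); apply: le_trans h1 _.
rewrite le_eqVlt; apply/orP; left; apply/eqP.
by field; rewrite !gt_eqF.
Qed.

End energy_arithmetic.
Theorem lemma4p1 (R : realType) (d : nat) (Omega : set 'rV[R]_d)
    (CP M CI H nu mu delta : R)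
    (f : ('rV[R]_d -> 'rV[R]_d) -> R)
    (I_H : ('rV[R]_d -> 'rV[R]_d) -> 'rV[R]_d -> 'rV[R]_d)
    (u eps : 'rV[R]_d -> 'rV[R]_d)
    (N : nat) (xs : 'I_N -> 'rV[R]_d) (eps_ : 'I_N -> 'rV[R]_d)
    (u_ : nat -> 'rV[R]_d -> 'rV[R]_d) :
  (d = 2 \/ d = 3)%N ->
  ns_domain Omega ->
  poincare Omega CP ->
  b_bound Omega M ->
  0 < nu -> 0 < mu -> 0 < H -> 0 < CI ->
  Hm1space Omega f ->
  0 < alpha Omega M nu f ->
  interpolation Omega CI H I_H ->
  steady_NSE Omega nu f u ->
  grad_Linfty Omega u ->
  Vspace Omega eps ->
  (forall i, I_H eps (xs i) = eps_ i) ->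
  0 <= delta ->
  norm2 Omega (grad Omega (u + eps)) <=
    (1 + delta) * norm2 Omega (grad Omega u) ->
  cda_picard Omega nu mu I_H f u eps u_ ->
  forall k : nat,
    (nu / 2 * norm2 Omega (grad Omega (u_ k.+1)) ^+ 2 +
       lambda_hat nu mu CI H * norm2 Omega (u_ k.+1) ^+ 2
     <= nu^-1 * norm_m1 Omega f ^+ 2 +
        2 * mu * CI ^+ 2 * CP ^+ 2 * nu ^- 2 * norm_m1 Omega f ^+ 2 +
        2 * mu * norm2 Omega (I_H eps) ^+ 2)
    /\ (mu <= nu / (2 * CI ^+ 2 * H ^+ 2) ->
        norm2 Omega (u_ k.+1) ^+ 2
        <= 2 * mu^-1 * nu^-1 * norm_m1 Omega f ^+ 2 +
           4 * CI ^+ 2 * CP ^+ 2 * nu ^- 2 * norm_m1 Omega f ^+ 2 +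
           4 * norm2 Omega (I_H eps) ^+ 2).
Proof.
move=> _ [oO _ _] HP bM nu0 mu0 H0 CI0 Hf _ [Ilin IL2 Iapx Ibd] [Vu NSEu] _ Veps _ _ _
  [Vk iter] k.
have mO : measurable Omega := open_measurable_rV oO.
have LI v : Xspace Omega v -> L2mx Omega (I_H v).
  by move=> Xv i j; rewrite (ord1 i); exact: IL2.
have [Xu _] := Vu; have [Xe _] := Veps.
have Vv := Vk k.+1; have Vw := Vk k; have [Xv _] := Vv.
have Xue : Xspace Omega (u + eps) by rewrite -[u]scale1r; exact: X_lin.
set Nf := norm_m1 Omega f.
have normG (v : 'rV[R]_d -> 'rV[R]_d) :
    inner Omega (grad Omega v) (grad Omega v) = norm2 Omega (grad Omega v) ^+ 2.
  by rewrite sqr_norm2.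
have gu : norm2 Omega (grad Omega u) ^+ 2 <= nu ^- 2 * Nf ^+ 2.
  have := NSEu _ Vu; rewrite (bform_skew oO bM Vu Xu) addr0 normG.
  have := Hm1_le oO Hf Xu; rewrite -/Nf.
  have := norm2_ge0 (Omega := Omega) (grad Omega u).
  move: (norm2 _ _) (f u) => g fu g0 h1 h2.
  exact: (energy_bound nu0 g0 h2 h1).
have bal := iter k _ Vv; rewrite (bform_skew oO bM Vw Xv) addr0 normG in bal.
set v := u_ k.+1 in Vv Xv bal *.
have LE := L2mx_lin mO 1 (LI _ Xu) (LI _ Xe).
(* I_H is linear only almost everywhere, hence I_H (u + eps) has to be replaced
   under the integral. *)
have cE : inner Omega (I_H v - I_H (u + eps)) (I_H v) =
    inner Omega (I_H v) (I_H v) - inner Omega (1 *: I_H u + I_H eps) (I_H v).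
  have -> : I_H v - I_H (u + eps) = -1 *: I_H (u + eps) + I_H v.
    by rewrite scaleN1r addrC.
  rewrite (inner_lin mO (-1) (LI _ Xue) (LI _ Xv) (LI _ Xv)) mulN1r addrC.
  congr (_ - _).
  apply: (ae_eq_inner mO (LI _ Xue) LE (LI _ Xv) (LI _ Xv)).
    by have := Ilin 1 _ _ Xu Xe; rewrite scale1r.
  by apply: aeW.
rewrite cE in bal.
have first : nu / 2 * norm2 Omega (grad Omega v) ^+ 2 +
    lambda_hat nu mu CI H * norm2 Omega v ^+ 2 <=
    nu^-1 * Nf ^+ 2 + 2 * mu * CI ^+ 2 * CP ^+ 2 * nu ^- 2 * Nf ^+ 2 +
    2 * mu * norm2 Omega (I_H eps) ^+ 2.
  apply: (energy_balance nu0 mu0 H0 CI0 bal (Hm1_le oO Hf Xv)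
    (inner_young mO LE (LI _ Xv)) (A := inner Omega (I_H u) (I_H u))
    (s := inner Omega (I_H v - v) (I_H v - v)) _ _ _ _ gu).
  - have := inner_lin_le mO 1 (LI _ Xu) (LI _ Xe).
    by rewrite expr1n mulr1 sqr_norm2.
  - have LD : L2mx Omega (I_H v - v).
      rewrite -scaleN1r addrC; apply: L2mx_lin => //; last exact: LI.
      exact: L2mx_X.
    have := inner_lin_le mO (-1) LD (LI _ Xv).
    rewrite scaleN1r opprB subrK sqr_norm2 sqrrN expr1n mulr1.
    by rewrite addrC.
  - rewrite -sqr_norm2; apply: lerXn2r; rewrite ?nnegrE ?norm2_ge0//.
      by rewrite !mulr_ge0 ?norm2_ge0// ltW.
    exact: Iapx.
  - rewrite -sqr_norm2 -mulrA -!exprMn; apply: lerXn2r; rewrite ?nnegrE ?norm2_ge0//.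
      rewrite mulr_ge0 ?(ltW CI0)//.
      by apply: le_trans (HP _ Xu); exact: norm2_ge0.
    apply: le_trans (Ibd _ Xu) _; apply: ler_wpM2l; first exact: ltW.
    exact: HP.
  - exact: inner_ge0.
  - exact: inner_ge0.
  - exact: sqr_ge0.
split=> // hmu; apply: (energy_small_mu nu0 mu0 (g := norm2 Omega (grad Omega v))).
by rewrite -(lambda_hat_small_mu H0 CI0 hmu).
Qed.
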